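(* Consider the work-conserving max-weight scheduler with the simplex rate region $\mathcal{R}_s=\{\mathbf{r}\in\mathbb{R}_+^K:\sum_{k=1}^K r^k/C^k\le1\}$. Let $\boldsymbol{\mu}\in\mathrm{int}(\mathcal{R}_s)$, and let $\{\mathbf{A}^L\}_{L\in\mathbb{N}}$ be a sequence of arrival processes in $\mathcal{D}^K_{\boldsymbol{\mu}}$ such that: (i) $\{\mathbf{A}^L\}$ satisfies a sample path LDP in $\mathcal{D}^K_{\boldsymbol{\mu}}$, equipped with the scaled uniform topology, with rate function $I^\sharp$; for every $t\in\mathbb{N}$, $\{\mathbf{A}^L|_{(0,t]}\}$ satisfies an LDP in $\mathbb{R}_+^{K\times t}$ (product topology) with rate function $I^\sharp_t$; and $I^\sharp(\mathbf{a})=\sup_{t\in\mathbb{N}}I^\sharp_t(\mathbf{a}|_{(0,t]})=\lim_{t\to\infty}I^\sharp_t(\mathbf{a}|_{(0,t]})$ for $\mathbf{a}\in\mathcal{D}^K_{\boldsymbol{\mu}}$; (ii) for every $t\in\mathbb{N}$, $I^\sharp_t$ is continuous on $\mathbb{R}_+^{K\times t}$ in the product topology; (iii) for every $\mathbf{a}\in\mathcal{D}^K_{\boldsymbol{\mu}}$ with $I^\sharp(\mathbf{a})<+\infty$ and every sequence $\{\mathbf{a}^n\}$ converging to $\mathbf{a}$ in $\mathcal{D}^K_{\boldsymbol{\mu}}$ for which there exists $t\in\mathbb{N}$ with $\mathbf{a}^n_s=\mathbf{a}_s$ for all $s>t$ and all $n$, we have $I^\sharp(\mathbf{a}^n)\to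 I^\sharp(\mathbf{a})$. Then the sequence of infinite-horizon workloads $\{\mathcal{W}^L:=G^{\mathrm{wc}}(\mathbf{A}^L)\}_L$ satisfies an LDP on $\mathbb{R}_+^K$ with good rate function $J$ given for $\mathbf{b}\in\mathbb{R}_+^K$ by $$J(\mathbf{b})=\inf\{I^\sharp(\mathbf{a}):\ \mathbf{a}\in\mathcal{D}^K_{\boldsymbol{\mu}},\ \mathbf{b}\in{}^{\mathbf{a}}G^{\mathrm{wc}}\}.$$
   Context: Conventions: $\mathbb{N}=\{1,2,\dots\}$, $K\in\mathbb{N}$, $C^1,\dots,C^K>0$ (so $C^k$, also written $C_k$, is the maximum service rate of queue $k$ in $\mathcal{R}_s$), $[\mathbf{x}]^+=\max\{\mathbf{0},\mathbf{x}\}$ coordinatewise; $\mathrm{int}(B):=\{\boldsymbol{\lambda}\in B:\exists\boldsymbol{\lambda}'\in B,\ \boldsymbol{\lambda}<\boldsymbol{\lambda}'\text{ coordinatewise}\}$; $\mathrm{Proj}$ is (Euclidean) projection. Quasi-continuity: a function $F:\mathcal{X}\to\mathcal{Y}$ between complete metric spaces is quasi-continuous if for each $x\in\mathcal{X}$ there is a sequence $x_n\to x$ with $F(x_n)\to F(x)$ such that $F$ is continuous at every $x_n$. Cluster set: for $F:\mathcal{X}\to\mathcal{Y}$ and $x\in\mathcal{X}$, ${}^{x}F:=\{y\in\mathcal{Y}:\exists\,x_n\to x\text{ with }F(x_n)\to y\}$; for $G^{\mathrm{wc}}$ take $\mathcal{X}=\mathcal{D}^K_{\boldsymbol{\mu}}$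 with the scaled uniform topology. Scheduler and workload: fixed are quasi-continuous functions $H,H^{\mathrm{wc}}:\mathbb{R}_+^K\to\mathcal{R}_s$ with $H(\mathbf{w})\in\arg\max_{\mathbf{R}\in\mathcal{R}_s}\langle\mathbf{R},\mathbf{w}\rangle$ for all $\mathbf{w}$, $H^{\mathrm{wc}}(\mathbf{w})=\mathrm{Proj}_{\mathcal{R}_s}(\mathbf{w})$ if $\mathbf{w}\in\prod_{k=1}^K[0,C_k)$ and $H^{\mathrm{wc}}(\mathbf{w})=H(\mathbf{w})$ otherwise (work-conserving max-weight). For arrivals $(\mathbf{a}_s)_{s\in\mathbb{N}}$, $\mathbf{a}_s\in\mathbb{R}_+^K$ being the work arriving at time $-s$, the workload started from $\mathbf{W}_T=\mathbf{0}$ at time $-T$ evolves by $\mathbf{W}_{s-1}=[\mathbf{W}_s-H^{\mathrm{wc}}(\mathbf{W}_s)]^++\mathbf{a}_s$, $s=T,\dots,1$. With $\mathbf{a}|_{(m_1,m_2]}=(\mathbf{a}_{m_1+1},\dots,\mathbf{a}_{m_2})$, $G^{\mathrm{wc}}_T(\mathbf{a}|_{(0,T]}):=\mathbf{W}_0$. The infinite-horizon workload is $G^{\mathrm{wc}}(\mathbf{a}):=\lim_{T\to\infty}G^{\mathrm{wc}}_T(\mathbf{a}|_{(0,T]})$ (the limit is assumed to exist). Sample-path space: for $x:\mathbb{N}\to\mathbb{R}_+$ put $x(0,t]=\sum_{s=1}^t x_s$. $\mathcal{D}$ is the set of such $x$ with $\|x\|_u:=\sup_{t\in\mathbb{N}}|x(0,t]/t|<\infty$,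 with metric $\|x-y\|_u=\sup_t|(x(0,t]-y(0,t])/t|$ (the scaled uniform topology). $\mathcal{D}_\mu:=\{x\in\mathcal{D}:\lim_{t\to\infty}x(0,t]/t=\mu\}$, and $\mathcal{D}^K_{\boldsymbol{\mu}}:=\prod_k\mathcal{D}_{\mu^k}$ with the product topology (norm $\max_k\|a^k\|_u$). Arrivals: for each $L$, $\mathbf{A}^L=(A^{k,L},k=1,\dots,K)$ with $A^{k,L}=(A^{k,L}_t,t\in\mathbb{N})$ a stationary $\mathbb{R}_+$-valued random sequence; arrivals to different queues are mutually independent; $\boldsymbol{\mu}$ is the vector of expected arrival rates. LDP: random elements $X^L$ of a Hausdorff space $\mathcal{X}$ with $\sigma$-algebra $\mathcal{B}$ (Borel) satisfy an LDP with good rate function $I:\mathcal{X}\to\mathbb{R}_+\cup\{\infty\}$ if all level sets $\{x:I(x)\le\alpha\}$, $\alpha\in\mathbb{R}$, are compact and, for every $B\in\mathcal{B}$ with interior $B^o$ and closure $\bar B$, $-\inf_{x\in B^o}I(x)\le\liminf_{L\to\infty}\frac1L\log P(X^L\in B)\le\limsup_{L\to\infty}\frac1L\log P(X^L\in B)\le-\inf_{x\in\bar B}I(x)$. All LDPs here, including those in the hypotheses, are in this sense; a sample path LDP is an LDP for random sequences. *)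

(* Defs.v *)
From HB Require Import structures.
From mathcomp Require Import all_boot all_order all_algebra.
From mathcomp Require Import all_classical all_reals all_analysis.
Set Implicit Arguments.
Unset Strict Implicit.
Unset Printing Implicit Defensive.
Import Order.TTheory GRing.Theory Num.Theory.
Import numFieldNormedType.Exports.
Local Open Scope classical_set_scope.
Local Open Scope ring_scope.

(* Time is the set {1, 2, ...}: a sequence x_1, x_2, ... is encoded by
   x : nat -> R, where [x s] is x_(s+1).  Sequences of random elements indexed
   by L = 1, 2, ... are encoded in the same way, [n : nat] standing for
   L = n.+1. *)

Definition quasi_continuous (X Y : topologicalType) (F : X -> Y) :=
  forall x, exists u : nat -> X,
    [/\ u @ \oo --> x, F \o u @ \oo --> F x &
        forall n, {for u n, continuous F}].

Definition cluster_set (X Y : topologicalType) (F : X -> Y) (x : X) : set Y :=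
  [set y | exists u : nat -> X, u @ \oo --> x /\ F \o u @ \oo --> y].

Definition borel (X : topologicalType) : set (set X) := <<s @open X >>.

Definition random_element d (Omega : measurableType d) (X : topologicalType)
    (Z : Omega -> X) :=
  forall B, borel B -> measurable (Z @^-1` B).

Section large_deviations.
Local Open Scope ereal_scope.
Context {R : realType}.

Definition good_rate_function (X : topologicalType) (I : X -> \bar R) :=
  (forall x, 0 <= I x) /\
  (forall alpha : R, compact [set x | I x <= alpha%:E]).

(* [lne 0 = -oo] and the infimum over the empty set is [+oo]. *)
Definition ldp (d : nat -> measure_display)
    (Omega : forall n, measurableType (d n))
    (P : forall n, probability (Omega n) R)
    (X : topologicalType) (Z : forall n, Omega n -> X) (I : X -> \bar R) :=
  good_rate_function I /\
  forall B : set X, borel B ->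
    let u n := (n.+1%:R^-1)%:E * lne (P n (Z n @^-1` B)) in
    [/\ - ereal_inf (I @` B°) <= limn_einf u,
        limn_einf u <= limn_esup u &
        limn_esup u <= - ereal_inf (I @` closure B)].

End large_deviations.

Definition cumul (R : realType) (x : nat -> R) (t : nat) : R :=
  \sum_(s < t) x s.

Definition scaled_sums (R : realType) (x : nat -> R) : set R :=
  [set `|cumul x t / t%:R| | t in [set t | (0 < t)%N]].

(* [sup] is junk on unbounded sets; [path_bounded] below rules them out. *)
Definition scaled_norm (R : realType) (x : nat -> R) : R := sup (scaled_sums x).

Record sample_path (R : realType) := SamplePath {
  path_fun :> nat -> R;
  path_ge0 : forall s, 0 <= path_fun s;
  path_bounded : has_ubound (scaled_sums path_fun) }.

HB.instance Definition _ (R : realType) := gen_eqMixin (sample_path R).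
HB.instance Definition _ (R : realType) := gen_choiceMixin (sample_path R).

Definition path_dist (R : realType) (x y : sample_path R) : R :=
  scaled_norm (fun s => x s - y s).

Section path_metric.
Context {R : realType}.
Implicit Types x y z : sample_path R.

Lemma cumulB (f g : nat -> R) t :
  cumul (fun s => f s - g s) t = cumul f t - cumul g t.
Proof. by rewrite /cumul sumrB. Qed.

Lemma cumul_inj (f g : nat -> R) :
  (forall t, (0 < t)%N -> cumul f t = cumul g t) -> f = g.
Proof.
move=> fg; apply/funext => s.
have E : cumul f s = cumul g s.
  by case: s => [|s]; [rewrite /cumul !big_ord0|exact: fg].
have := fg s.+1 isT; rewrite /cumul !big_ord_recr /= -/(cumul f s).
by rewrite -/(cumul g s) E => /addrI.
Qed.

Lemma path_dist_ub x y : has_ubound (scaled_sums (fun s => x s - y s)).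
Proof.
have [M HM] := path_bounded x; have [N HN] := path_bounded y.
exists (M + N) => _ [t /= t0 <-].
rewrite cumulB mulrBl (le_trans (ler_normB _ _))// lerD//.
  by apply: HM; exists t.
by apply: HN; exists t.
Qed.

Lemma path_dist_ubP x y t : (0 < t)%N ->
  `|(cumul x t - cumul y t) / t%:R| <= path_dist x y.
Proof.
move=> t0; rewrite -cumulB; apply: sup_upper_bound; last by exists t.
split; last exact: path_dist_ub.
by exists `|cumul (fun s => x s - y s) 1 / 1%:R|; exists 1%N.
Qed.

Lemma path_dist_le x y e :
  (forall t, (0 < t)%N -> `|(cumul x t - cumul y t) / t%:R| <= e) ->
  path_dist x y <= e.
Proof.
move=> H; apply: ge_sup => [|_ [t t0 <-]]; last by rewrite cumulB; exact: H.
by exists `|cumul (fun s => x s - y s) 1 / 1%:R|; exists 1%N.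
Qed.

Lemma path_distxx x : path_dist x x = 0.
Proof.
apply/eqP; rewrite eq_le path_dist_le/= => [|t _]; last first.
  by rewrite subrr mul0r normr0.
exact: le_trans (path_dist_ubP x x (ltn0Sn 0)).
Qed.

Lemma path_dist_eq0 x y : path_dist x y = 0 -> x = y.
Proof.
move=> xy0; have E : path_fun x = path_fun y.
  apply: cumul_inj => t t0; apply/eqP; rewrite -subr_eq0.
  have := path_dist_ubP x y t0; rewrite xy0 normr_le0 mulf_eq0 invr_eq0.
  by rewrite pnatr_eq0 (gtn_eqF t0) orbF.
case: x y {xy0} E => [f f0 fb] [g g0 gb] /= E; subst g.
by congr SamplePath; exact: Prop_irrelevance.
Qed.

Lemma path_dist_sym x y : path_dist x y = path_dist y x.
Proof.
by rewrite /path_dist /scaled_norm /scaled_sums; congr sup;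
  apply/seteqP; split => _ [t t0 <-]; exists t => //;
  rewrite !cumulB -opprB mulNr normrN.
Qed.

Lemma path_dist_triangle y x z :
  path_dist x z <= path_dist x y + path_dist y z.
Proof.
apply: path_dist_le => t t0.
have -> : cumul x t - cumul z t =
    (cumul x t - cumul y t) + (cumul y t - cumul z t).
  by rewrite addrA subrK.
by rewrite mulrDl (le_trans (ler_normD _ _))// lerD// path_dist_ubP.
Qed.

End path_metric.

HB.instance Definition _ (R : realType) := @isMetric.Build R (sample_path R)
  (@path_dist R) path_distxx path_dist_eq0 path_dist_sym path_dist_triangle.

Definition mean_path (R : realType) (m : R) : set (sample_path R) :=
  [set x | (cumul x t / t%:R) @[t --> \oo] --> m].

(* Paths of all queues, with the product of the scaled uniform topologies. *)
Definition arrivals (R : realType) (K : nat) (mu : 'rV[R]_K) :=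
  prod_topology (fun k : 'I_K => mean_path (mu 0 k) : Type).

HB.instance Definition _ (R : realType) (K : nat) (mu : 'rV[R]_K) :=
  Topological.copy (arrivals mu)
    (prod_topology (fun k : 'I_K => mean_path (mu 0 k) : Type)).

Definition arrival (R : realType) (K : nat) (mu : 'rV[R]_K)
  (a : arrivals mu) (k : 'I_K) (s : nat) : R := set_val (a k) s.

Definition nonneg_mx (R : realType) (m n : nat) : set 'M[R]_(m, n) :=
  [set M | forall i j, 0 <= M i j].
Arguments nonneg_mx R m n : clear implicits.

(* R_+^K is [orthant R 1 K] (row vectors); R_+^(K x t) is [orthant R K t]. *)
Definition orthant (R : realType) (m n : nat) : Type := nonneg_mx R m n.

HB.instance Definition _ (R : realType) (m n : nat) :=
  PseudoMetric.copy (orthant R m n) (nonneg_mx R m n : Type).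

Section orthant.
Context {R : realType}.

Definition omx {m n} (M : orthant R m n) : 'M[R]_(m, n) := set_val M.

Definition mk_orthant {m n} (M : 'M[R]_(m, n)) (M0 : nonneg_mx R m n M) :
  orthant R m n := exist _ M (mem_set M0).

Lemma mk_orthantK {m n} (M : 'M[R]_(m, n)) (M0 : nonneg_mx R m n M) :
  omx (mk_orthant M0) = M.
Proof. by rewrite /omx set_valE. Qed.

Lemma omx_ge0 {m n} (M : orthant R m n) : nonneg_mx R m n (omx M).
Proof. exact: set_valP. Qed.

Lemma zero_ge0 m n : nonneg_mx R m n 0.
Proof. by move=> i j; rewrite mxE. Qed.

Definition ozero {m n} : orthant R m n := mk_orthant (@zero_ge0 m n).

Lemma trcol_ge0 {m n} (M : orthant R m n) (s : 'I_n) :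
  nonneg_mx R 1 m (\row_i omx M i s).
Proof. by move=> i j; rewrite mxE; exact: omx_ge0. Qed.

Definition slot {m n} (M : orthant R m n) (s : 'I_n) : orthant R 1 m :=
  mk_orthant (trcol_ge0 M s).

End orthant.

HB.instance Definition _ (R : realType) (m n : nat) :=
  isPointed.Build (orthant R m n) ozero.

Lemma window_ge0 (R : realType) (K : nat) (mu : 'rV[R]_K) (a : arrivals mu)
    (t : nat) : nonneg_mx R K t (\matrix_(k, s) arrival a k s).
Proof. by move=> k s; rewrite mxE; exact: path_ge0. Qed.

(* a restricted to (0, t]; column s holds the arrivals at time s + 1. *)
Definition window (R : realType) (K : nat) (mu : 'rV[R]_K) (a : arrivals mu)
  (t : nat) : orthant R K t := mk_orthant (@window_ge0 R K mu a t).

Section scheduler.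
Context {R : realType} {K : nat}.
Implicit Types (C : 'I_K -> R) (v w : 'rV[R]_K).

Definition simplex C : set 'rV[R]_K :=
  [set r | (forall k, 0 <= r 0 k) /\ \sum_k r 0 k / C k <= 1].

(* This is not the topological interior: lambda may have zero coordinates. *)
Definition region_int (B : set 'rV[R]_K) : set 'rV[R]_K :=
  [set l | B l /\ exists2 l', B l' & forall k, l 0 k < l' 0 k].

Definition inner v w : R := \sum_k v 0 k * w 0 k.

(* The norm of the library on matrices is the max-norm. *)
Definition euclid_dist v w : R := Num.sqrt (\sum_k (v 0 k - w 0 k) ^+ 2).

Definition is_euclid_proj (B : set 'rV[R]_K) w p :=
  B p /\ forall r, B r -> euclid_dist w p <= euclid_dist w r.

Definition max_weight C (H : orthant R 1 K -> simplex C) :=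
  forall (w : orthant R 1 K) r,
    simplex C r -> inner r (omx w) <= inner (set_val (H w)) (omx w).

(* The lower bounds of the box prod_k [0, C_k) hold for all w. *)
Definition work_conserving C (H Hwc : orthant R 1 K -> simplex C) :=
  forall w : orthant R 1 K,
    ((forall k, omx w 0 k < C k) ->
       is_euclid_proj (simplex C) (omx w) (set_val (Hwc w))) /\
    (~ (forall k, omx w 0 k < C k) -> Hwc w = H w).

Section workload.
Context (C : 'I_K -> R) (Hwc : orthant R 1 K -> simplex C).

Lemma step_ge0 (w a : orthant R 1 K) : nonneg_mx R 1 K
  (\row_k (Num.max 0 (omx w 0 k - set_val (Hwc w) 0 k) + omx a 0 k)).
Proof.
by move=> i k; rewrite mxE addr_ge0 ?le_max ?lexx//; exact: omx_ge0.
Qed.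

Definition step (w a : orthant R 1 K) : orthant R 1 K :=
  mk_orthant (step_ge0 w a).

(* Arrivals are numbered backwards in time: the last column is consumed
   first, by the zero initial workload, and the first column last. *)
Definition workload (T : nat) (M : orthant R K T) : orthant R 1 K :=
  foldr (fun s x => step x (slot M s)) ozero (enum 'I_T).

Definition workload_infty (mu : 'rV[R]_K) (a : arrivals mu) : orthant R 1 K :=
  limn (fun T => workload (window a T)).

End workload.
End scheduler.

Definition stationary d (Omega : measurableType d) (R : realType)
    (P : probability Omega R) (X : Omega -> nat -> R) :=
  forall (n h : nat) (B : set 'rV[R]_n), borel B ->
    P [set w | B (\row_(i < n) X w i)] =
    P [set w | B (\row_(i < n) X w (h + i)%N)].

(* Taking B k = setT for some k gives the product rule for subfamilies. *)
Definition independent_queues d (Omega : measurableType d) (R : realType)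
    (P : probability Omega R) (K : nat) (mu : 'rV[R]_K)
    (A : Omega -> arrivals mu) :=
  forall B : forall k : 'I_K, set (mean_path (mu 0 k)),
    (forall k, borel (B k)) ->
    P [set w | forall k, B k (A w k)] =
    (\prod_(k < K) P [set w | B k (A w k)])%E.

(* Main.v *)
Require Import Defs.
From HB Require Import structures.
From mathcomp Require Import all_boot all_order all_algebra.
From mathcomp Require Import all_classical all_reals all_analysis.
From mathcomp Require Import ring lra.
Set Implicit Arguments.
Unset Strict Implicit.
Unset Printing Implicit Defensive.
Import Order.TTheory GRing.Theory Num.Theory.
Import numFieldNormedType.Exports.
Local Open Scope classical_set_scope.
Local Open Scope ring_scope.

(** The workload map G sends an arrival path a to its infinite-horizon
    workload.  It is discontinuous, but a contraction principle survives
    ([ldp_contraction]).  The upper bound and the goodness of J only use that G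
    is locally bounded.  The lower bound at a value b in the cluster set of G
    at a requires points a' at which I is nearly I(a) and which have a whole
    neighbourhood mapped by G close to b.  Since I is only known to vary
    continuously under modifications of a inside a fixed window (0, t], such
    points a' must agree with a beyond t: the workload near a must be decided
    by a bounded window.

    Put c = min_k C_k and measure a workload w by <C, w>.  A service step empties
    every w of the simplex and lowers <C, w> by at least c^2 for every other w
    ([cost_leftover_simplex]); for max-weight steps this holds although they may
    waste capacity, because the queue j that is served has C_j w_j >= c^2.  Two
    regimes follow.

    If <C, mu> < c^2, then <C, W_s> is dominated by a stable Lindley recursion
    driven by <C, a_s>, whose emptying times depend on the arrivals only.  Every
    path near a is emptied at some time of a common window (0, T], whatever its
    past, so that G coincides near a with the finite run over (0, T]
    ([workload_infty_local]).  This gives local boundedness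
    ([workload_infty_bounded]).  A finite run is quasi-continuous, and continuity
    points are reached by raising the arrivals slightly ([run_quasi]): in the box
    the projection is continuous, and outside it quasi-continuity forces H to
    select a vertex C_j e_j, which raising queue j a little more than the
    others makes the strict and stable maximizer.  Grafting the raised window on
    the tail of a gives the points a' ([workload_infty_approximation]).

    If <C, mu> >= c^2, the limits that define G do not exist for all paths
    ([divergent_arrivals]), so the hypothesis on G excludes this regime.  Indeed
    capacity can then be wasted forever: let k0 have the smallest rate c and
    hold slightly more than c, while every step brings one batch to a single
    queue j, just large enough (about c^2 / C_j) to win the comparison
    C_j w_j > c w_k0.  The batch is served at once and the residual of k0 is
    never touched, whereas a system without residual stays without residual
    under the same batches.  The frequencies and sizes of the batches can be
    chosen to have mean mu, because the load of mu is less than 1 and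
    <C, mu> >= c^2 ([batch_sizes]).  A short burst exchanges the two situations, no residual and
    residual: it creates a residual where there is none, and doubles an existing
    one, which then loses two comparisons, falls below c and is discarded.  Such
    swaps, inserted with vanishing density, leave the mean unchanged, and the
    finite-horizon workload then depends on the parity of the number of swaps
    inside the horizon. *)

(** * An extended contraction principle *)

Section limits.
Context {R : realType}.
Local Open Scope ereal_scope.

Lemma le_limn_esup (u v : (\bar R)^nat) :
  (forall n, u n <= v n) -> limn_esup u <= limn_esup v.
Proof.
move=> uv; rewrite !limn_esup_lim; apply: lee_lim; [exact: is_cvg_esups..|].
apply: nearW => n; apply: ge_ereal_sup => _ [m nm <-].
by rewrite (le_trans (uv m))//; apply: ereal_sup_ubound; exists m.
Qed.

Lemma le_limn_einf (u v : (\bar R)^nat) :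
  (forall n, u n <= v n) -> limn_einf u <= limn_einf v.
Proof. by move=> uv; rewrite leeN2; apply: le_limn_esup => n; rewrite leeN2. Qed.

Lemma le_log_probability d (T : measurableType d) (P : probability T R) (n : nat)
    (A B : set T) :
  measurable A -> measurable B -> A `<=` B ->
  n.+1%:R^-1%:E * lne (P A) <= n.+1%:R^-1%:E * lne (P B).
Proof.
move=> mA mB AB; apply: lee_wpmul2l; first by rewrite lee_fin.
by rewrite lee_lne ?in_itv/= ?measure_ge0 ?leey//; apply: le_measure; rewrite ?inE.
Qed.

End limits.

Section borel_sets.
Context {X : topologicalType}.

Lemma borel_open (B : set X) : open B -> borel B.
Proof. exact: sub_sigma_algebra. Qed.

Lemma borel_closed (B : set X) : closed B -> borel B.
Proof.
move=> cB; rewrite -(setCK B) -setTD; apply: sigma_algebraCD.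
by apply: borel_open; rewrite openC.
Qed.

End borel_sets.

Section contraction.
Context {R : realType}.

(** What is needed of the topology to replace the sequences of a cluster set by
    neighbourhoods. *)
Definition nbhs_sequence (X : topologicalType) (x : X) (V : nat -> set X) :=
  [/\ forall n, nbhs x (V n), forall m n, (m <= n)%N -> V n `<=` V m &
      forall A, nbhs x A -> exists n, V n `<=` A].

(** The graph of the cluster sets is the closure of the graph of [F]; every
    later use of cluster sets goes through this description. *)
Lemma cluster_setP (X : topologicalType) (Y : pseudoMetricType R) (F : X -> Y)
    (x : X) (y : Y) : (exists V, nbhs_sequence x V) ->
  cluster_set F x y <->
  forall U V, nbhs x U -> nbhs y V -> exists2 z, U z & V (F z).
Proof.
move=> [W [Wx Wdec Wbase]]; split=> [[u [ux uy]] U V xU yV|H].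
  have : \forall n \near \oo, U (u n) /\ V (F (u n)).
    by apply: filterI; [exact: ux|exact: uy].
  by case=> n _ /(_ n (leqnn n)) [Uu Vu]; exists (u n).
have e0 n : 0 < n.+1%:R^-1 :> R by rewrite invr_gt0.
have /choice[u Hu] n : exists z, W n z /\ ball y n.+1%:R^-1 (F z).
  have [z Wz yz] := H (W n) (ball y n.+1%:R^-1) (Wx n)
    (nbhsx_ballx y _ (e0 n)).
  by exists z.
exists u; split.
  move=> A /Wbase[n WA]; exists n => // m /= nm; apply: WA.
  by apply: (Wdec _ _ nm); have [] := Hu m.
move=> A /nbhs_ballP[e /= e_gt0 eA].
have [N _ HN] := near_infty_natSinv_lt (PosNum e_gt0).
exists N => // m /= Nm; apply: eA.
by apply: (@le_ball _ _ _ m.+1%:R^-1); [exact/ltW/HN|have [] := Hu m].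
Qed.

(** The function [F] is arbitrary, hence the two hypotheses that replace its
    continuity.  By local boundedness, images of points that approach [x]
    have limit values, which belong to the cluster set at [x]; this gives compact level
    sets and the upper bound.  The
    approximation hypothesis says that a value in the cluster set at [x] is
    attained approximately on an open set, at nearly the same cost as [x]; applying the
    lower bound for [Z] to that open set gives the lower bound for [F]. *)
Theorem ldp_contraction (d : nat -> measure_display)
    (Omega : forall n, measurableType (d n)) (P : forall n, probability (Omega n) R)
    (X : topologicalType) (Y : pseudoMetricType R)
    (Z : forall n, Omega n -> X) (F : X -> Y) (I : X -> \bar R) :
  hausdorff_space X -> hausdorff_space Y ->
  (forall x : X, exists V, nbhs_sequence x V) ->
  (forall n, random_element (Z n)) ->
  (forall n, random_element (F \o Z n)) ->
  (forall x : X, exists2 U, nbhs x U & exists2 K : set Y, compact K & F @` U `<=` K) ->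
  (forall (x : X) (y : Y) U (r : \bar R), (I x < r)%E -> cluster_set F x y -> nbhs y U ->
     exists2 x' : X, (I x' < r)%E & nbhs x' (F @^-1` U)) ->
  ldp P Z I ->
  ldp P (fun n => F \o Z n)
    (fun y => ereal_inf [set I x | x in [set x | cluster_set F x y]]).
Proof.
move=> hX hY baseX Zm FZm Fbd Fapp [[I0 Icpt] IZ].
pose J (y : Y) := ereal_inf [set I x | x in [set x | cluster_set F x y]].
rewrite -/J.
have J_le x y : cluster_set F x y -> (J y <= I x)%E.
  by move=> xy; apply: ereal_inf_lbound; exists x.
have closedI a : closed [set x | I x <= a%:E]%E by exact: compact_closed.
split.
  split=> [y|a]; first by apply: le_ereal_inf_tmp => _ [x _ <-]; exact: I0.
  move=> G PG Ga.
  (* The infimum that defines J is not attained a priori, so the pairs of a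
     value y and a point x with I x at most a + e are filtered jointly. *)
  pose S (A : set Y) (e : R) : set (X * Y) :=
    [set xy | [/\ A xy.2, cluster_set F xy.1 xy.2 & (I xy.1 <= (a + e)%:E)%E]].
  pose D := [set Ae : set Y * R | G Ae.1 /\ 0 < Ae.2].
  pose GS := filter_from D (fun Ae => S Ae.1 Ae.2).
  have GSI : Filter GS.
    apply: filter_from_filter; first by exists (setT, 1); split => //; exact: filterT.
    move=> [A e] [B f] [/= GA e0] [/= GB f0].
    exists (A `&` B, Num.min e f); first by split; [exact: filterI|rewrite lt_min e0].
    move=> [x y] [/= [Ay By] xy Ix]; split; split=> //=;
      by rewrite (le_trans Ix)// lee_fin lerD2l ge_min lexx ?orbT.
  have PGS : ProperFilter GS.
    apply: filter_from_proper => // -[A e] [/= GA e0].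
    have [y [Ay Jy]] : (A `&` [set y | J y <= a%:E]%E) !=set0.
      by apply: (@filter_ex _ G); exact: filterI.
    have : (J y < (a + e)%:E)%E by rewrite (le_lt_trans Jy)// lte_fin ltrDl.
    move=> /ereal_inf_lt[_ [x xy <-]] /ltW Ix.
    by exists (x, y).
  have GSS A e : G A -> 0 < e -> GS (S A e) by move=> GA e0; exists (A, e).
  have [x0 [Ix0 clx0]] : [set x | I x <= (a + 1)%:E]%E `&` cluster (fst @ GS) !=set0.
    apply: Icpt; exists (setT, 1); first by split => //; exact: filterT.
    by move=> [x y] [].
  have Ix0a : (I x0 <= a%:E)%E.
    apply/lee_addgt0Pr => e e0; apply: closedI => U xU.
    apply: clx0 => //; exists (setT, e); first by split => //; exact: filterT.
    by move=> [x y] [].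
  have [U xU [K cK FUK]] := Fbd x0.
  (* the points of the filter whose first component is near [x0] *)
  pose GU := filter_from [set SV : set (X * Y) * set X | GS SV.1 /\ nbhs x0 SV.2]
     (fun SV => [set y | exists2 x, SV.2 x & SV.1 (x, y)]).
  have PGU : ProperFilter GU.
    apply: filter_from_proper.
      apply: filter_from_filter; first by exists (setT, setT); split; exact: filterT.
      move=> [S1 V1] [S2 V2] [/= s1 v1] [/= s2 v2].
      exists (S1 `&` S2, V1 `&` V2); first by split; exact: filterI.
      by move=> y [x [? ?] [? ?]]; split; exists x.
    move=> [S1 V1] [/= s1 v1].
    have [|x [[[x' y] sxy /= <-] Vx]] := clx0 (fst @` S1) V1 _ v1.
      by apply: filterS s1 => xy Sxy; exists xy.
    by exists y; exists x'.
  have GUK : GU K.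
    exists (S setT 1, U°); first by split; [apply: GSS => //; exact: filterT|
      exact: nbhs_interior].
    move=> y [x /= Ux [_ /= xy _]].
    apply: (compact_closed hY cK) => V yV.
    have [z Uz Vz] := (iffLR (cluster_setP _ _ (baseX x)) xy) _ _ Ux yV.
    by exists (F z); split => //; apply: FUK; exists z => //; exact: interior_subset.
  have [y0 [Ky0 cly0]] := cK _ PGU GUK.
  exists y0; split.
    rewrite /= (le_trans _ Ix0a)//; apply: J_le; apply/(cluster_setP _ _ (baseX x0)).
    move=> V W xV yW.
    have [|y [[x /= Vx [_ /= xy _]] Wy]] := cly0 [set y | exists2 x, V° x & S setT 1 (x, y)] W° _ (nbhs_interior yW).
      exists (S setT 1, V°); last by [].
      by split; [apply: GSS => //; exact: filterT|exact: nbhs_interior].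
    have [z Vz Wz] := (iffLR (cluster_setP _ _ (baseX x)) xy) _ _ Vx Wy.
    by exists z.
  move=> A W GA yW.
  have [|y [[x _ [/= Ay _ _]] Wy]] := cly0 [set y | exists2 x, setT x & S A 1 (x, y)] W _ yW.
    by exists (S A 1, setT) => //; split => //; [exact: GSS|exact: filterT].
  by exists y.
move=> B bB u; split; [|exact: limn_einf_sup|].
  rewrite -leeN2 oppeK; apply: le_ereal_inf_tmp => _ [y By <-].
  apply: le_ereal_inf_tmp => _ [x xy <-].
  have [->|Ixoo] := eqVneq (I x) +oo%E; first by rewrite leey.
  apply/lee_addgt0Pr => e e0.
  have [x' Ix' Bx'] : exists2 x', (I x' < I x + e%:E)%E & nbhs x' (F @^-1` B°).
    apply: (Fapp x y) => //; last exact: nbhs_interior.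
    by rewrite lteDl ?lte_fin// ge0_fin_numE// ltey.
  have [lowO _ _] := IZ (F @^-1` B°)° (borel_open (open_interior _)).
  rewrite (le_trans _ (ltW Ix'))// leeNl (le_trans _ (le_trans lowO _))//.
    rewrite leeN2; apply: ereal_inf_lbound; exists x' => //.
    exact: nbhs_interior.
  apply: le_limn_einf => n; apply: le_log_probability; [|exact: FZm|].
    by apply: Zm; apply: borel_open; exact: open_interior.
  by move=> w /interior_subset /interior_subset.
have [_ _ uppG] := IZ (closure (F @^-1` closure B)) (borel_closed (@closed_closure _ _)).
apply: (@le_trans _ _ (limn_esup (fun n => (n.+1%:R^-1%:E *
    lne (P n (Z n @^-1` closure (F @^-1` closure B))))%E))).
  apply: le_limn_esup => n; apply: le_log_probability; [exact: FZm| |].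
    by apply: Zm; apply: borel_closed; exact: closed_closure.
  by move=> w /= Bw; apply: subset_closure; exact: subset_closure.
apply: (le_trans uppG); rewrite leeN2; apply: le_ereal_inf_tmp => _ [x + <-].
rewrite -(proj1 (closure_id _) (@closed_closure _ _)) => clx.
have [U xU [K cK FUK]] := Fbd x.
(* the images of the points near [x] accumulate inside the compact [K] *)
pose GV := filter_from (nbhs x) (fun V => F @` (V `&` (F @^-1` closure B))).
have PGV : ProperFilter GV.
  apply: filter_from_proper.
    apply: filter_from_filter; first by exists setT; exact: filterT.
    move=> V W xV xW; exists (V `&` W); first exact: filterI.
    by move=> _ [z [[Vz Wz] Bz] <-]; split; exists z.
  by move=> V /clx [z [Bz Vz]]; exists (F z); exists z.
have [y [Ky cly]] : K `&` cluster GV !=set0.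
  by apply: cK; exists U => // _ [z [Uz _] <-]; apply: FUK; exists z.
have By : closure B y.
  apply: closed_closure => W yW.
  have [|w [[z [_ Bz] <-] Ww]] := cly (F @` (setT `&` (F @^-1` closure B))) W _ yW.
    by exists setT; first exact: filterT.
  by exists (F z).
apply: (@le_trans _ _ (J y)); first by apply: ereal_inf_lbound; exists y.
apply: J_le; apply/(cluster_setP _ _ (baseX x)) => V W xV yW.
have [|w [[z [Vz _] <-] Ww]] := cly (F @` (V `&` (F @^-1` closure B))) W _ yW.
  by exists V.
by exists z.
Qed.

End contraction.

(** * The spaces of workloads and of arrival paths *)

Section orthant_topology.
Context {R : realType}.

Lemma nbhs_orthantP m n (b : orthant R m n) (A : set (orthant R m n)) :
  nbhs b A <-> exists2 e, 0 < e &
    forall x, (forall i j, `|omx b i j - omx x i j| < e) -> A x.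
Proof.
split=> [/nbhs_ballP[e /= e0 eA]|[e e0 eA]].
  by exists e => // x bx; apply: eA; split.
by apply/nbhs_ballP; exists e => // x [_ bx]; apply: eA => i j; exact: bx.
Qed.

Lemma max0_lipschitz (x y : R) : `|Num.max 0 x - Num.max 0 y| <= `|x - y|.
Proof.
have h1 := ler_norm (x - y); have h2 := ler_norm (y - x).
rewrite distrC in h2; rewrite ler_norml.
by case: (lerP 0 x) => ?; case: (lerP 0 y) => ?; apply/andP; split; lra.
Qed.

Lemma omx_inj m n : injective (@omx R m n).
Proof. exact: val_inj. Qed.

Lemma orthant_hausdorff m n : hausdorff_space (orthant R m n).
Proof.
move=> x y xy; apply: omx_inj; apply/matrixP => i j; apply/eqP.
rewrite -subr_eq0 -normr_le0 leNgt; apply/negP; set e := `| _ | => e0.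
have e20 : 0 < e / 2 by lra.
pose N (z : orthant R m n) := [set w | `|omx z i j - omx w i j| < e / 2].
have NN z : nbhs z (N z) by apply/nbhs_orthantP; exists (e / 2) => // w; exact.
have [w [/= xw yw]] := xy _ _ (NN x) (NN y).
have := ler_distD (omx w i j) (omx x i j) (omx y i j).
by rewrite -/e (distrC (omx w i j)); move: xw yw; rewrite /N/=; lra.
Qed.

(** The box is the image of a compact box of row vectors under the positive
    part. *)
Lemma box_compact n (M : R) :
  compact [set b : orthant R 1 n | forall k, omx b 0 k <= M].
Proof.
have clip_ge0 (v : 'rV[R]_n) : nonneg_mx R 1 n (\row_k Num.max 0 (v 0 k)).
  by move=> i j; rewrite mxE le_max lexx.
pose clip v : orthant R 1 n := mk_orthant (clip_ge0 v).
have clipE v k : omx (clip v) 0 k = Num.max 0 (v 0 k) by rewrite mk_orthantK mxE.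
rewrite (_ : [set b | _] = clip @` [set v : 'rV[R]_n | forall k, `[0, M]%classic (v ord0 k)]).
  apply: continuous_compact; last first.
    by apply: (@rV_compact R n (fun=> `[0, M]%classic)) => k; exact: segment_compact.
  apply: continuous_subspaceT => v A /nbhs_orthantP[e e0 eA].
  apply/nbhs_ballP; exists e => // w [_ vw]; apply: eA => i k.
  rewrite (ord1 i) !clipE; apply: le_lt_trans (vw 0 k).
  exact: max0_lipschitz.
apply/seteqP; split=> [b bM|_ [v vM <-] k]; last first.
  by rewrite clipE; have := vM k; rewrite /= in_itv/= => /andP[v0 vkM]; rewrite max_r.
exists (omx b) => [k|]; first by rewrite /= in_itv/= bM andbT; exact: omx_ge0.
by apply: omx_inj; apply/rowP => k; rewrite clipE max_r//; exact: omx_ge0.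
Qed.

End orthant_topology.

Section arrivals_topology.
Context {R : realType} {K : nat} {mu : 'rV[R]_K}.
Implicit Types a x : arrivals mu.

Definition arrivals_ball a (e : R) : set (arrivals mu) :=
  [set x | forall k, path_dist (set_val (a k)) (set_val (x k)) < e].

(** There are finitely many queues, so uniform closeness in all queues is a
    basis of the product topology. *)
Lemma nbhs_arrivalsP a (A : set (arrivals mu)) :
  nbhs a A <-> exists2 e, 0 < e & arrivals_ball a e `<=` A.
Proof.
split=> [aA|[e e0 eA]].
  pose G := filter_from [set e : R | 0 < e] (arrivals_ball a).
  have FG : Filter G.
    apply: filter_from_filter; first by exists 1 => /=.
    move=> e f /= e0 f0; exists (Num.min e f); first by rewrite /= lt_min e0.
    by move=> x xef; split=> k; have := xef k; rewrite lt_min => /andP[].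
  suff : G --> a by move=> /(_ _ aA).
  apply/cvg_sup => k U [_ [[V oV <-] /= Va] VU].
  have : nbhs (a k) V by exact: open_nbhs_nbhs.
  move=> /nbhs_ballP[e /= e0 eV]; exists e => // x xe; apply: VU.
  exact/eV/xe.
apply: filterS eA _.
apply: (@filter_forall _ _ (fun k (x : arrivals mu) =>
  path_dist (set_val (a k)) (set_val (x k)) < e) (nbhs a)) => k.
have := @proj_continuous _ (fun k : 'I_K => mean_path (mu 0 k) : topologicalType) k a.
move=> /(_ [set x | path_dist (set_val (a k)) (set_val x) < e]); apply.
by apply/nbhs_ballP; exists e.
Qed.

Lemma nbhs_arrivals_ball a e : 0 < e -> nbhs a (arrivals_ball a e).
Proof. by move=> e0; apply/nbhs_arrivalsP; exists e. Qed.

Lemma arrivals_nbhs_sequence a : exists V, nbhs_sequence a V.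
Proof.
exists (fun n => arrivals_ball a n.+1%:R^-1); split.
- by move=> n; apply: nbhs_arrivals_ball; rewrite invr_gt0.
- move=> m n mn x ax k; apply: lt_le_trans (ax k) _.
  by rewrite lef_pV2 ?posrE// ler_nat.
- move=> A /nbhs_arrivalsP[e e0 eA].
  have [n _ /(_ n (leqnn n)) ne] := near_infty_natSinv_lt (PosNum e0).
  by exists n => x ax; apply: eA => k; exact: lt_trans (ax k) ne.
Qed.

Lemma arrivals_eq a x : (forall k s, arrival a k s = arrival x k s) -> a = x.
Proof.
move=> ax; apply/functional_extensionality_dep => k; apply: val_inj.
apply: (@path_dist_eq0 R (set_val (a k)) (set_val (x k))).
have E : path_fun (set_val (a k)) = path_fun (set_val (x k)) by apply/funext => s; exact: ax.
by rewrite -(path_distxx (set_val (x k))) /path_dist E.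
Qed.

Lemma cumul_dist a x e k t : arrivals_ball a e x ->
  `|cumul (arrival a k) t - cumul (arrival x k) t| <= e * t%:R.
Proof.
move=> ax; case: t => [|t]; first by rewrite /cumul !big_ord0 subrr normr0 mulr0.
rewrite -ler_pdivrMr// -[X in _ / X]ger0_norm// -normf_div.
by rewrite (le_trans (path_dist_ubP _ _ _))// ltW.
Qed.

(** An arrival is the difference of two consecutive partial sums, each of
    which is controlled by the scaled norm times its horizon. *)
Lemma arrival_dist a x e k s : arrivals_ball a e x ->
  `|arrival a k s - arrival x k s| <= e * (s.*2.+1)%:R.
Proof.
move=> ax; have := cumul_dist k s ax; have := cumul_dist k s.+1 ax.
rewrite /cumul !big_ord_recr/= -/(cumul _ s) -/(cumul _ s).
set u := cumul (arrival a k) s; set v := cumul _ s.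
move=> h1 h2; rewrite (_ : _ - _ = (u + arrival a k s - (v + arrival x k s)) - (u - v)); last by ring.
rewrite (le_trans (ler_normB _ _))//.
rewrite -addnn -addSn natrD mulrDr; exact: lerD.
Qed.

Lemma arrivals_hausdorff : hausdorff_space (arrivals mu).
Proof.
move=> a x ax; apply: arrivals_eq => k s; apply/eqP.
rewrite -subr_eq0 -normr_le0 leNgt; apply/negP; set e := `| _ | => e0.
pose N := (s.*2.+1)%:R : R; have N0 : 0 < N by rewrite ltr0n.
have f0 : 0 < e / (3 * N) by rewrite divr_gt0// mulr_gt0.
have [z [/= az xz]] := ax _ _ (nbhs_arrivals_ball a f0) (nbhs_arrivals_ball x f0).
have := ler_distD (arrival z k s) (arrival a k s) (arrival x k s).
have := arrival_dist k s az; have := arrival_dist k s xz.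
have EN : e / (3 * N) * N = e / 3 by field; rewrite gt_eqF.
by rewrite -/e -/N EN (distrC (arrival z k s)); lra.
Qed.

(** A convergent sequence is bounded, so that the mean rate alone decides
    whether nonnegative sequences form an arrival path. *)
Lemma arrivals_of_mean (x : nat -> 'I_K -> R) :
  (forall s k, 0 <= x s k) ->
  (forall k, (cumul (x ^~ k) t / t%:R) @[t --> \oo] --> mu 0 k) ->
  exists a : arrivals mu, forall k s, arrival a k s = x s k.
Proof.
move=> x0 xmu.
have bd k : has_ubound (scaled_sums (x ^~ k)).
  have /cvg_seq_bounded [M [_ HM]] : cvgn (fun t => cumul (x ^~ k) t / t%:R).
    by apply/cvg_ex; exists (mu 0 k); exact: xmu.
  by exists (M + 1) => _ [t _ <-]; apply: HM => //; rewrite ltrDl.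
pose p k : sample_path R := SamplePath (fun s => x0 s k) (bd k).
have pm k : mean_path (mu 0 k) (p k) by exact: xmu.
by exists (fun k => exist _ (p k) (mem_set (pm k))) => k s; rewrite /arrival set_valE.
Qed.

End arrivals_topology.

(** * One service step *)

Section service.
Context {R : realType} {K : nat} (C : 'I_K -> R) (H Hwc : orthant R 1 K -> simplex C).
Hypotheses (C_gt0 : forall k, 0 < C k).
Hypotheses (H_mw : max_weight H) (Hwc_wc : work_conserving H Hwc).
Implicit Types w : orthant R 1 K.

(** The work left after service, before the next arrivals. *)
Definition leftover w (k : 'I_K) : R := Num.max 0 (omx w 0 k - set_val (Hwc w) 0 k).

(** The lower bounds of the box hold for all workloads of the orthant. *)
Definition in_box w := forall k, omx w 0 k < C k.

(** The Lyapunov functional of the scheduler.  Compared with the load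
    [\sum_k x k / C k], queues with a large rate weigh more, which is what makes the
    bound on its decrease per step insensitive to wasted capacity. *)
Definition cost (x : 'I_K -> R) : R := \sum_k C k * x k.

Lemma step_leftover w a k : omx (step Hwc w a) 0 k = leftover w k + omx a 0 k.
Proof. by rewrite mk_orthantK mxE. Qed.

Lemma leftover_ge0 w k : 0 <= leftover w k.
Proof. by rewrite le_max lexx. Qed.

Lemma simplex_vertex j : simplex C (\row_k if k == j then C j else 0).
Proof.
split=> [k|]; first by rewrite mxE; case: eqP => // _; exact: ltW.
rewrite (bigD1 j)//= mxE eqxx divff ?gt_eqF// big1 ?addr0// => k kj.
by rewrite mxE (negbTE kj) mul0r.
Qed.

(** First-order optimality of the nearest point of a convex set, obtained by
    comparing [p] with the points [p + t (r - p)]. *)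
Lemma euclid_proj_variational w p r : is_euclid_proj (simplex C) (omx w) p ->
  simplex C r -> \sum_k (omx w 0 k - p 0 k) * (r 0 k - p 0 k) <= 0.
Proof.
move=> [[p0 p1] pmin] [r0 r1]; rewrite leNgt; apply/negP; set a := \sum_k _ => a_gt0.
pose b := \sum_k (r 0 k - p 0 k) ^+ 2.
have b0 : 0 <= b by apply: sumr_ge0 => k _; exact: sqr_ge0.
(* This step makes the quadratic term smaller than the linear one. *)
pose t := a / (a + b).
have t0 : 0 < t by rewrite divr_gt0// ltr_wpDr.
have t1 : t <= 1 by rewrite ler_pdivrMr ?mul1r ?lerDl// ltr_wpDr.
have rt : simplex C (\row_k (p 0 k + t * (r 0 k - p 0 k))).
  split=> [k|].
    rewrite mxE (_ : _ + _ = (1 - t) * p 0 k + t * r 0 k); last by ring.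
    by apply: addr_ge0; apply: mulr_ge0; rewrite ?subr_ge0//; exact: ltW.
  rewrite (eq_bigr (fun k => (1 - t) * (p 0 k / C k) + t * (r 0 k / C k))) => [|k _]; last by rewrite mxE; ring.
  rewrite big_split/= -!mulr_sumr (le_trans (lerD (ler_wpM2l _ p1) (ler_wpM2l _ r1)))//.
  - by rewrite subr_ge0.
  - exact: ltW.
  - by rewrite !mulr1 subrK.
have := pmin _ rt; rewrite /euclid_dist ler_sqrt; last first.
  by apply: sumr_ge0 => k _; exact: sqr_ge0.
rewrite (_ : \sum_k (omx w 0 k - (\row_k _) 0 k) ^+ 2 =
    \sum_k (omx w 0 k - p 0 k) ^+ 2 - 2 * t * a + t ^+ 2 * b); last first.
  rewrite /a /b !mulr_sumr -sumrB -big_split/=; apply: eq_bigr => k _.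
  by rewrite mxE; ring.
have tab : t * (a + b) = a by rewrite /t divfK// gt_eqF// ltr_wpDr.
have : t * b < 2 * a.
  by move: tab; rewrite mulrDr; have := mulr_gt0 t0 a_gt0; lra.
by rewrite -(ltr_pM2l t0) (_ : t * (t * b) = t ^+ 2 * b); [lra|ring].
Qed.

Lemma box_proj w : in_box w ->
  is_euclid_proj (simplex C) (omx w) (set_val (Hwc w)).
Proof. by have [+ _] := Hwc_wc w; exact. Qed.

Lemma Hwc_simplex w : simplex C (set_val (Hwc w)).
Proof. exact: set_valP. Qed.

(** Lowering an excessive coordinate of the projection stays in the simplex
    and comes closer to [w]. *)
Lemma box_proj_le w k : in_box w -> set_val (Hwc w) 0 k <= omx w 0 k.
Proof.
move=> /box_proj wp; set p := set_val (Hwc w).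
rewrite leNgt; apply/negP => pk.
have [p0 p1] := Hwc_simplex w.
have rs : simplex C (\row_i if i == k then omx w 0 k else p 0 i).
  split=> [i|]; first by rewrite mxE; case: eqP => _; [exact: omx_ge0|exact: p0].
  apply: le_trans p1; apply: ler_sum => i _; rewrite mxE ler_pM2r ?invr_gt0//.
  by case: eqP => [->|]//; exact: ltW.
have := euclid_proj_variational wp rs.
rewrite (bigD1 k)//= big1 => [|i ik]; last by rewrite mxE (negbTE ik) subrr mulr0.
rewrite mxE eqxx addr0 -expr2 leNgt => /negP; apply.
by rewrite exprn_even_gt0//= subr_eq0 lt_eqF.
Qed.

(** If the projection did not use the full capacity, some coordinate below
    that of [w] could be raised. *)
Lemma box_proj_sum w : in_box w -> ~ simplex C (omx w) ->
  \sum_k set_val (Hwc w) 0 k / C k = 1.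
Proof.
move=> wbox ws; have wp := box_proj wbox; have [p0 p1] := Hwc_simplex w.
set p := set_val (Hwc w) in wp p0 p1 *.
apply/eqP; rewrite eq_le p1/= leNgt; apply/negP => pl.
have [k pk] : exists k, p 0 k < omx w 0 k.
  apply/not_existsP => wp'; apply: ws; split=> [k|]; first exact: omx_ge0.
  apply: le_trans p1; apply: ler_sum => k _; rewrite ler_pM2r ?invr_gt0//.
  by rewrite leNgt; apply/negP; exact: wp'.
pose t := C k * (1 - \sum_k p 0 k / C k).
have t0 : 0 < t by rewrite mulr_gt0// subr_gt0.
have rs : simplex C (\row_i (p 0 i + if i == k then t else 0)).
  split=> [i|]; first by rewrite mxE addr_ge0//; case: eqP => // _; exact: ltW.
  under eq_bigr do rewrite mxE mulrDl.
  rewrite big_split/= [X in _ + X](bigD1 k)//= eqxx [X in _ + (_ + X)]big1 => [|i ik].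
    by rewrite addr0 /t mulrC mulKf ?gt_eqF// subrKC.
  by rewrite (negbTE ik) mul0r.
have := euclid_proj_variational wp rs.
rewrite (bigD1 k)//= big1 => [|i ik]; last by rewrite mxE (negbTE ik) addr0 subrr mulr0.
rewrite mxE eqxx addr0 leNgt => /negP; apply.
by rewrite (addrC (p 0 k)) addrK mulr_gt0// subr_gt0.
Qed.

(** A maximizer of a linear functional over the simplex lies in the face
    spanned by the vertices of maximal weight. *)
Lemma max_weight_support w m : 0 < m -> (forall k, C k * omx w 0 k <= m) ->
  (exists k, C k * omx w 0 k = m) ->
  let p := set_val (H w) in
  \sum_k p 0 k / C k = 1 /\ forall k, p 0 k = 0 \/ C k * omx w 0 k = m.
Proof.
move=> m0 wm [j wj] p; have [p0 p1] : simplex C p by exact: set_valP.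
have := H_mw w (simplex_vertex j).
rewrite /inner (bigD1 j)//= mxE eqxx wj big1 => [|k kj]; last first.
  by rewrite mxE (negbTE kj) mul0r.
rewrite addr0 -/p => mp.
have E : \sum_k p 0 k * omx w 0 k = m * (\sum_k p 0 k / C k) -
    \sum_k p 0 k / C k * (m - C k * omx w 0 k).
  rewrite mulr_sumr -sumrB; apply: eq_bigr => k _.
  by field; rewrite gt_eqF.
have T0 k : 0 <= p 0 k / C k * (m - C k * omx w 0 k).
  by rewrite mulr_ge0 ?divr_ge0 ?subr_ge0 ?p0//; exact: ltW.
have S0 : 0 <= \sum_k p 0 k / C k * (m - C k * omx w 0 k) by exact: sumr_ge0.
have p1' : m * (\sum_k p 0 k / C k) <= m by rewrite ger_pMr.
split.
  by apply: (mulfI (lt0r_neq0 m0)); rewrite mulr1; lra.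
move=> k; have /eqP : \sum_k p 0 k / C k * (m - C k * omx w 0 k) = 0 by lra.
rewrite psumr_eq0// => /allP/(_ k); rewrite mem_index_enum => /(_ isT)/=.
rewrite mulf_eq0 mulf_eq0 invr_eq0 (gt_eqF (C_gt0 k)) orbF subr_eq0.
by move=> /orP[/eqP ->|/eqP ->]; [left|right].
Qed.

Lemma out_of_box w : ~ in_box w -> (exists k, C k <= omx w 0 k) /\ Hwc w = H w.
Proof.
move=> wb; split; last by have [_ ->] := Hwc_wc w.
by apply: contrapT => /forallNP wC; apply: wb => k; rewrite ltNge; apply/negP.
Qed.

Lemma max_weight_vertex w j : 0 < C j * omx w 0 j ->
  (forall k, k != j -> C k * omx w 0 k < C j * omx w 0 j) ->
  set_val (H w) = \row_k if k == j then C j else 0.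
Proof.
move=> m0 wj.
have wj' k : C k * omx w 0 k <= C j * omx w 0 j.
  by have [->//|/wj/ltW] := eqVneq k j.
have [|p1 pj] := max_weight_support m0 wj'; first by exists j.
have pk k : k != j -> set_val (H w) 0 k = 0.
  by move=> /wj wkj; have [//|wE] := pj k; move: wkj; rewrite wE ltxx.
apply/rowP => k; rewrite mxE; case: eqP => [->|/eqP/pk//].
move: p1; rewrite (bigD1 j)//= big1 ?addr0 => [|i' /pk->]; last by rewrite mul0r.
by move=> /(canRL (mulfVK (lt0r_neq0 (C_gt0 j)))) ->; rewrite mul1r.
Qed.

Lemma leftover_max w j : ~ in_box w ->
  (forall k, k != j -> C k * omx w 0 k < C j * omx w 0 j) ->
  set_val (Hwc w) = \row_k if k == j then C j else 0.
Proof.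
move=> /out_of_box[[i wi] ->] wj; apply: max_weight_vertex => //.
have w0 : 0 < C i * omx w 0 i by rewrite mulr_gt0// (lt_le_trans (C_gt0 i)).
by have [<-//|/wj] := eqVneq i j; exact: lt_trans.
Qed.

Lemma leftover_maxE w j k : ~ in_box w ->
  (forall k, k != j -> C k * omx w 0 k < C j * omx w 0 j) ->
  leftover w k = if k == j then Num.max 0 (omx w 0 j - C j) else omx w 0 k.
Proof.
move=> wb wj; rewrite /leftover (leftover_max wb wj) mxE; case: eqP => [->//|_].
by rewrite subr0 max_r//; exact: omx_ge0.
Qed.

(** In the box, [w] is its own projection.  A point of the simplex outside the
    box is a vertex [C j e_j], where max-weight selects the same vertex. *)
Lemma leftover_simplex w k : simplex C (omx w) -> leftover w k = 0.
Proof.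
move=> ws; have w0 := omx_ge0 w 0.
have [wb|wb] := pselect (in_box w).
  have /euclid_proj_variational/(_ ws) := box_proj wb.
  under eq_bigr do rewrite -expr2.
  rewrite le_eqVlt ltNge sumr_ge0/= ?orbF; last by move=> *; exact: sqr_ge0.
  rewrite psumr_eq0 => [/allP/(_ k)|*]; last exact: sqr_ge0.
  rewrite mem_index_enum => /(_ isT)/=; rewrite sqrf_eq0 => /eqP E.
  by rewrite /leftover E maxxx.
have [[j wj] _] := out_of_box wb.
have [_ w1] := ws; rewrite (bigD1 j)//= in w1.
have wj1 : 1 <= omx w 0 j / C j by rewrite ler_pdivlMr// mul1r.
have S0 : 0 <= \sum_(i | i != j) omx w 0 i / C i.
  by apply: sumr_ge0 => i _; rewrite divr_ge0//; exact: ltW.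
have wi i : i != j -> omx w 0 i = 0.
  move=> ij; have /eqP : \sum_(i | i != j) omx w 0 i / C i = 0 by lra.
  rewrite psumr_eq0 => [/allP/(_ i)|l _]; last by rewrite divr_ge0//; exact: ltW.
  rewrite mem_index_enum ij => /(_ isT)/=.
  by rewrite mulf_eq0 invr_eq0 (gt_eqF (C_gt0 i)) orbF => /eqP.
have wjC : omx w 0 j = C j.
  have /(canRL (mulfVK (lt0r_neq0 (C_gt0 j)))) : omx w 0 j / C j = 1 by lra.
  by rewrite mul1r.
rewrite (leftover_maxE _ wb (j := j)) => [|i /wi ->].
  by case: eqP => [_|/eqP/wi//]; rewrite wjC subrr maxxx.
by rewrite mulr0 wjC mulr_gt0.
Qed.

Section cost.
Context (c : R).
Hypotheses (c_gt0 : 0 < c) (c_le : forall k, c <= C k).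

(** In the box the served vector [p] satisfies [p <= w] and uses the full
    capacity, so its cost is an average of the [C k ^+ 2].  Outside the box, some
    [w i >= C i], hence every queue [k] that is served has
    [C k * w k >= C i * w i >= c ^+ 2]: even if it holds less work than its rate,
    emptying it lowers the cost by at least [c ^+ 2]. *)
Lemma cost_leftover_simplex w : ~ simplex C (omx w) ->
  cost (leftover w) <= cost (omx w 0) - c ^+ 2.
Proof.
move=> ws; have w0 := omx_ge0 w 0.
have cC k : c ^+ 2 <= C k ^+ 2 by rewrite lerXn2r// nnegrE ltW.
have pCE (p : R) k : C k * p = p / C k * C k ^+ 2 by field; rewrite gt_eqF.
suff [p1 pd] : \sum_k set_val (Hwc w) 0 k / C k = 1 /\ forall k,
    C k * leftover w k <= C k * omx w 0 k - set_val (Hwc w) 0 k / C k * c ^+ 2.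
  rewrite -[leRHS](_ : cost (omx w 0) - \sum_k set_val (Hwc w) 0 k / C k * c ^+ 2 = _).
    by rewrite -sumrB; exact: ler_sum.
  by rewrite -mulr_suml p1 mul1r.
have [wb|wb] := pselect (in_box w).
  split; first exact: box_proj_sum.
  move=> k; have pw := box_proj_le k wb; have [p0 _] := Hwc_simplex w.
  rewrite /leftover max_r ?subr_ge0// mulrBr lerD2l lerN2 pCE.
  by rewrite ler_wpM2l// divr_ge0//; exact: ltW.
have [[i wi] HwE] := out_of_box wb.
pose j := [arg max_(k > i) (C k * omx w 0 k)]%O.
have wj k : C k * omx w 0 k <= C j * omx w 0 j.
  by rewrite /j; case: Order.TotalTheory.arg_maxP => //= l _; exact.
have cwi : c ^+ 2 <= C i * omx w 0 i.
  by rewrite (le_trans (cC i))// expr2 ler_pM2l.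
have m0 : 0 < C j * omx w 0 j.
  by rewrite (lt_le_trans _ (le_trans cwi (wj i)))// exprn_gt0.
have [|p1 pj] := max_weight_support m0 wj; first by exists j.
rewrite HwE; split => // k.
have [p0 _] : simplex C (set_val (H w)) by exact: set_valP.
have pC1 : set_val (H w) 0 k / C k <= 1.
  rewrite -p1 (bigD1 k)//= lerDl; apply: sumr_ge0 => l _.
  by rewrite divr_ge0//; exact: ltW.
have th0 : 0 <= set_val (H w) 0 k / C k by rewrite divr_ge0//; exact: ltW.
rewrite /leftover HwE; have [p_eq0|wkE] := pj k.
  by rewrite p_eq0 mul0r mul0r !subr0 max_r.
have [pw|wp] := lerP (set_val (H w) 0 k) (omx w 0 k).
  rewrite max_r ?subr_ge0// mulrBr lerD2l lerN2 pCE.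
  by rewrite ler_wpM2l.
rewrite max_l ?subr_le0; last exact: ltW.
rewrite mulr0 subr_ge0 wkE (le_trans _ (le_trans cwi (wj i)))//.
by rewrite ler_piMl// sqr_ge0.
Qed.

Lemma cost_leftover w : cost (leftover w) <= Num.max 0 (cost (omx w 0) - c ^+ 2).
Proof.
have [ws|ws] := pselect (simplex C (omx w)).
  by rewrite /cost big1 ?le_max ?lexx// => k _; rewrite leftover_simplex// mulr0.
by rewrite le_max cost_leftover_simplex// orbT.
Qed.

End cost.

End service.

(** * Runs of the scheduler and coupling below the critical load *)

Section runs.
Context {R : realType} {K : nat} (C : 'I_K -> R) (Hwc : orthant R 1 K -> simplex C).
Implicit Types (a b : nat -> orthant R 1 K).

(** The workload at time 0 of the system started empty at time [- T]; [a i]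
    arrives at time [- i.+1]. *)
Fixpoint run a (T : nat) : orthant R 1 K :=
  if T is T'.+1 then step Hwc (run (fun s => a s.+1) T') (a 0%N) else ozero.

(** Arrivals as seen from time [- s]. *)
Definition past (s : nat) a : nat -> orthant R 1 K := fun i => a (s + i)%N.

Lemma runSE a T k : omx (run a T.+1) 0 k = leftover Hwc (run (past 1 a) T) k + omx (a 0%N) 0 k.
Proof. exact: step_leftover. Qed.

Lemma eq_run a b T : (forall s, (s < T)%N -> a s = b s) -> run a T = run b T.
Proof.
elim: T a b => //= T IH a b ab; rewrite ab//; congr step.
by apply: IH => s sT; exact: ab.
Qed.

Lemma workloadE T (M : orthant R K T) a :
  (forall s : 'I_T, slot M s = a s) -> workload Hwc M = run a T.
Proof.
rewrite /workload; move: (slot M) => g {M}.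
elim: T g a => [|T IH] g a ga; first by rewrite enum_ord0.
rewrite enum_ordSl/= ga foldr_map; congr step.
by apply: IH => s; rewrite ga.
Qed.

Lemma leftover_le w k : leftover Hwc w k <= omx w 0 k.
Proof.
rewrite ge_max (omx_ge0 w 0 k) lerBlDr lerDl.
by have [+ _] := Hwc_simplex Hwc w; exact.
Qed.

Lemma run_le a T k : omx (run a T) 0 k <= \sum_(s < T) omx (a s) 0 k.
Proof.
elim: T a => [|T IH] a; first by rewrite big_ord0 mk_orthantK mxE.
by rewrite runSE big_ord_recl/= addrC lerD2l (le_trans (leftover_le _ _))// IH.
Qed.

(** If nothing is left after the service at time [- s.+1], the earlier arrivals
    are forgotten: the system behaves as if it started empty there. *)
Lemma run_regeneration a s n :
  (forall k, leftover Hwc (run (past s.+1 a) n) k = 0) ->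
  (forall k, leftover Hwc ozero k = 0) ->
  run a (s.+1 + n) = run a s.+1.
Proof.
move=> + o0; elim: s a => [|s IH] a Hs.
  apply: omx_inj; apply/rowP => k; rewrite (_ : 1 + n = n.+1)%N// !runSE.
  by rewrite Hs [X in leftover _ X]/= o0.
rewrite addSn; change (step Hwc (run (past 1 a) (s.+1 + n)) (a 0%N) =
  step Hwc (run (past 1 a) s.+1) (a 0%N)).
by congr step; apply: IH.
Qed.

End runs.

Section lindley.
Context {R : realType} {K : nat} (C : 'I_K -> R) (H Hwc : orthant R 1 K -> simplex C).
Hypotheses (C_gt0 : forall k, 0 < C k).
Hypotheses (H_mw : max_weight H) (Hwc_wc : work_conserving H Hwc).
Context (c : R).
Hypotheses (c_gt0 : 0 < c) (c_le : forall k, c <= C k).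
Implicit Types (a b : nat -> orthant R 1 K).

(** The recursion of the costs is dominated by a Lindley recursion, and the
    hypothesis says that the supremum which solves the latter is at most [B]. *)
Lemma cost_run_le b n (B : R) : 0 <= B ->
  (forall m, (m < n)%N -> \sum_(i < m.+1) cost C (omx (b i) 0) <= B + m%:R * c ^+ 2) ->
  cost C (omx (run Hwc b n) 0) <= B.
Proof.
elim: n b B => [|n IH] b B B0 qB.
  by rewrite /cost big1// => k _; rewrite mk_orthantK mxE mulr0.
have -> : cost C (omx (run Hwc b n.+1) 0) =
    cost C (leftover Hwc (run Hwc (past 1 b) n)) + cost C (omx (b 0%N) 0).
  by rewrite /cost -big_split; apply: eq_bigr => k _; rewrite runSE mulrDr.
have q0 : cost C (omx (b 0%N) 0) <= B.
  by have := qB 0%N isT; rewrite big_ord1 mul0r addr0.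
have := cost_leftover C_gt0 H_mw Hwc_wc c_gt0 c_le (run Hwc (past 1 b) n).
suff : cost C (omx (run Hwc (past 1 b) n) 0) <= B - cost C (omx (b 0%N) 0) + c ^+ 2.
  by rewrite le_max => ? /orP[]; lra.
apply: IH; first by rewrite addr_ge0 ?subr_ge0 ?sqr_ge0.
move=> m mn; have := qB m.+1 mn; rewrite big_ord_recl/= -natr1 mulrDl mul1r.
by rewrite /past; under [X in _ -> X <= _]eq_bigr do rewrite add1n; lra.
Qed.

(** The case [B = c ^+ 2] of the preceding bound: a workload of cost at most
    [c ^+ 2] is served completely. *)
Lemma leftover_run_eq0 b n k :
  (forall m, \sum_(i < m) cost C (omx (b i) 0) <= m%:R * c ^+ 2) ->
  leftover Hwc (run Hwc b n) k = 0.
Proof.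
move=> qb; have h1 := cost_leftover C_gt0 H_mw Hwc_wc c_gt0 c_le (run Hwc b n).
have h2 := @cost_run_le b n (c ^+ 2) (sqr_ge0 c).
have Q0 : cost C (leftover Hwc (run Hwc b n)) <= 0.
  suff /h2 : forall m, (m < n)%N ->
      \sum_(i < m.+1) cost C (omx (b i) 0) <= c ^+ 2 + m%:R * c ^+ 2.
    by move: h1; rewrite le_max => /orP[]; lra.
  by move=> m _; rewrite (le_trans (qb _))// -natr1 mulrDl mul1r addrC.
have T0 i : 0 <= C i * leftover Hwc (run Hwc b n) i.
  by rewrite mulr_ge0 ?leftover_ge0//; exact: ltW.
have /eqP : cost C (leftover Hwc (run Hwc b n)) = 0.
  by apply/eqP; rewrite eq_le Q0/=; exact: sumr_ge0.
rewrite psumr_eq0// => /allP/(_ k); rewrite mem_index_enum => /(_ isT)/=.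
by rewrite mulf_eq0 (gt_eqF (C_gt0 k)) => /eqP.
Qed.

Lemma leftover_ozero k : leftover Hwc ozero k = 0.
Proof.
apply: (leftover_simplex C_gt0 H_mw Hwc_wc); rewrite mk_orthantK; split=> [i|].
  by rewrite mxE.
by rewrite big1// => i _; rewrite mxE mul0r.
Qed.

(** Let [s] maximize [g t = \sum_(i < t) cost (a i) - t * c ^+ 2] over
    positive times.  Seen from [s], all partial sums of the cost are at most
    linear with slope [c ^+ 2], so the system is emptied at [s] whenever it was
    started before.  The hypothesis confines a maximizer to the first [T1] times. *)
Lemma run_coupling a T1 :
  (0 < T1)%N ->
  (forall t, (T1 < t)%N -> \sum_(i < t) cost C (omx (a i) 0) - t%:R * c ^+ 2
      <= cost C (omx (a 0%N) 0) - c ^+ 2) ->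
  forall T, (T1 <= T)%N -> run Hwc a T = run Hwc a T1.
Proof.
move=> T1_gt0 aT1.
pose g t := \sum_(i < t) cost C (omx (a i) 0) - t%:R * c ^+ 2.
have g1 : g 1%N = cost C (omx (a 0%N) 0) - c ^+ 2 by rewrite /g big_ord1 mul1r.
case: T1 T1_gt0 aT1 => // n _ aT1.
pose s := [arg max_(i > (@ord0 n)) g i.+1]%O.
have sg (i : 'I_n.+1) : g i.+1 <= g s.+1.
  by rewrite /s; case: Order.TotalTheory.arg_maxP => //= l _; exact.
have sgt t : (0 < t)%N -> g t <= g s.+1.
  case: t => // t _; have [tn|nt] := ltnP t n.+1; first exact: (sg (Ordinal tn)).
  by apply: le_trans (sg ord0); rewrite g1; exact: aT1.
have key T : (s < T)%N -> run Hwc a T = run Hwc a s.+1.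
  move=> sT; rewrite -(subnKC sT); apply: run_regeneration => k; last exact: leftover_ozero.
  apply: leftover_run_eq0 => m.
  have := sgt (s.+1 + m)%N isT; rewrite /g big_split_ord/= natrD mulrDl.
  by rewrite /past; lra.
by move=> T nT; rewrite key ?(leq_trans _ nT)// key.
Qed.

End lindley.

Section arrivals_runs.
Context {R : realType} {K : nat} {mu : 'rV[R]_K} (C : 'I_K -> R).
Context (H Hwc : orthant R 1 K -> simplex C).
Implicit Types a x : arrivals mu.

Lemma slice_ge0 a s : nonneg_mx R 1 K (\row_k arrival a k s).
Proof. by move=> i k; rewrite mxE; exact: path_ge0. Qed.

Definition slice a s : orthant R 1 K := mk_orthant (slice_ge0 a s).

Lemma sliceE a s k : omx (slice a s) 0 k = arrival a k s.
Proof. by rewrite mk_orthantK mxE. Qed.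

Lemma workload_window a T : workload Hwc (window a T) = run Hwc (slice a) T.
Proof.
apply: workloadE => s; apply: omx_inj; apply/rowP => k.
by rewrite sliceE mk_orthantK mxE mk_orthantK mxE.
Qed.

Hypotheses (C_gt0 : forall k, 0 < C k).
Hypotheses (H_mw : max_weight H) (Hwc_wc : work_conserving H Hwc).
Context (c : R).
Hypotheses (c_gt0 : 0 < c) (c_le : forall k, c <= C k).
Hypothesis mu_lt : cost C (mu 0) < c ^+ 2.

Lemma sum_cost_slice a t :
  \sum_(i < t) cost C (omx (slice a i) 0) = \sum_k C k * cumul (arrival a k) t.
Proof.
rewrite exchange_big/=; apply: eq_bigr => k _; rewrite mulr_sumr.
by apply: eq_bigr => i _; rewrite sliceE.
Qed.

(** The horizon can be chosen uniformly near [a] because the scaled uniform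
    norm controls the mean cost over all long windows at once. *)
Lemma coupling a : exists2 e, 0 < e & exists2 T1, (0 < T1)%N &
  forall x, arrivals_ball a e x -> forall T, (T1 <= T)%N ->
    run Hwc (slice x) T = run Hwc (slice x) T1.
Proof.
(* One third of the gap is spent on the mean of [a], one on the distance of
   [x] to [a], and one is left to absorb [c ^+ 2] after a long time. *)
pose dl := (c ^+ 2 - cost C (mu 0)) / 3.
have dl0 : 0 < dl by rewrite divr_gt0// subr_gt0.
pose S := \sum_k C k + 1.
have S0 : 0 < S by rewrite ltr_wpDl// sumr_ge0// => k _; exact: ltW.
have cv : (\sum_k C k * (cumul (arrival a k) t / t%:R)) @[t --> \oo] --> cost C (mu 0).
  rewrite /cost; apply: cvg_big => //=; first by exact: add_continuous.
  move=> k _; apply: cvgM; first exact: cvg_cst.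
  by have := set_valP (a k).
have [T0 _ HT0] : \forall t \near \oo,
    \sum_k C k * (cumul (arrival a k) t / t%:R) < cost C (mu 0) + dl.
  by apply: cvgr_lt cv _ _; rewrite ltrDl.
pose N := Num.bound (c ^+ 2 / dl).
have HN : c ^+ 2 < dl * N%:R.
  by rewrite -ltr_pdivrMl// mulrC archi_boundP// divr_ge0 ?sqr_ge0// ltW.
exists (dl / S); first exact: divr_gt0.
exists (maxn T0 N).+1 => // x ax; apply: (run_coupling C_gt0 H_mw Hwc_wc c_gt0 c_le) => // t Tt.
have t0 : (0 < t)%N by exact: leq_trans Tt.
have Nt : (N%:R <= t%:R :> R) by rewrite ler_nat (leq_trans _ (ltnW Tt))// ltnW// ltnS leq_maxr.
have /HT0 Ta : (T0 <= t)%N by rewrite (leq_trans _ (ltnW Tt))// ltnW// ltnS leq_maxl.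
have q0 : 0 <= cost C (omx (slice x 0) 0).
  by apply: sumr_ge0 => k _; rewrite mulr_ge0 ?omx_ge0//; exact: ltW.
suff : \sum_(i < t) cost C (omx (slice x i) 0) <= t%:R * (cost C (mu 0) + 2 * dl).
  have -> : c ^+ 2 = cost C (mu 0) + 3 * dl by rewrite /dl; field.
  have : dl * N%:R <= dl * t%:R by rewrite ler_pM2l.
  by move: HN; rewrite (_ : c ^+ 2 = cost C (mu 0) + 3 * dl); [lra|rewrite /dl; field].
rewrite sum_cost_slice.
apply: (@le_trans _ _ (\sum_k C k * (cumul (arrival a k) t + dl / S * t%:R))).
  apply: ler_sum => k _; rewrite ler_pM2l//.
  by have := cumul_dist k t ax; rewrite ler_norml; lra.
under eq_bigr do rewrite mulrDr; rewrite big_split/= -mulr_suml.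
have -> : \sum_k C k * cumul (arrival a k) t =
    t%:R * \sum_k C k * (cumul (arrival a k) t / t%:R).
  rewrite mulr_sumr; apply: eq_bigr => k _; field.
  by rewrite pnatr_eq0 -lt0n.
have SS : (\sum_k C k) * (dl / S * t%:R) <= dl * t%:R.
  rewrite mulrA ler_wpM2r// mulrCA ger_pMr// ler_pdivrMr// mul1r.
  by rewrite /S lerDl.
have : t%:R * (\sum_k C k * (cumul (arrival a k) t / t%:R)) <= t%:R * (cost C (mu 0) + dl).
  by rewrite ler_wpM2l//; exact: ltW.
by rewrite !mulrDr; lra.
Qed.

Lemma workload_infty_local a : exists2 e, 0 < e & exists2 T1, (0 < T1)%N &
  forall x, arrivals_ball a e x -> workload_infty Hwc x = run Hwc (slice x) T1.
Proof.
have [e e0 [T1 T1_gt0 HT1]] := coupling a.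
exists e => //; exists T1 => // x /HT1 xT1; apply: lim_near_cst.
  exact: orthant_hausdorff.
by exists T1 => // T /= TT; rewrite workload_window xT1.
Qed.

End arrivals_runs.

(** * Quasi-continuity of finite runs *)

Lemma finite_lower_bound (R : realType) (K : nat) (f : 'I_K -> R) :
  (forall k, 0 < f k) -> exists2 e, 0 < e & forall k, e <= f k.
Proof.
move=> f0; exists (\big[Num.min/1]_k f k); first by apply: lt_bigmin.
by move=> k; exact: bigmin_le_cond.
Qed.

Section quasi.
Context {R : realType} {K : nat} (C : 'I_K -> R) (H Hwc : orthant R 1 K -> simplex C).
Hypotheses (C_gt0 : forall k, 0 < C k).
Hypotheses (H_mw : max_weight H) (Hwc_wc : work_conserving H Hwc).
Implicit Types w : orthant R 1 K.

Lemma raise_ge0 w (v : 'I_K -> R) : (forall k, 0 <= v k) ->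
  nonneg_mx R 1 K (\row_k (omx w 0 k + v k)).
Proof. by move=> v0 i k; rewrite mxE addr_ge0//; exact: omx_ge0. Qed.

(** A perturbation that keeps the workload in the orthant. *)
Definition raise w (v : 'I_K -> R) (v0 : forall k, 0 <= v k) : orthant R 1 K :=
  mk_orthant (raise_ge0 w v0).

Lemma raiseE w v v0 k : omx (@raise w v v0) 0 k = omx w 0 k + v k.
Proof. by rewrite mk_orthantK mxE. Qed.

Hypothesis (K_gt0 : (0 < K)%N).

(** Raising the heaviest queue makes it the unique maximizer, so that vertices
    are among the limits of [H] at every point. *)
Lemma H_near_vertex w e : 0 < e -> {for w, continuous H} ->
  exists j, forall k, `|set_val (H w) 0 k - (if k == j then C j else 0)| < e.
Proof.
move=> e0 Hw.
pose j := [arg max_(k > Ordinal K_gt0) (C k * omx w 0 k)]%O.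
have wj k : C k * omx w 0 k <= C j * omx w 0 j.
  by rewrite /j; case: Order.TotalTheory.arg_maxP => //= l _; exact.
have : nbhs w (H @^-1` [set r : simplex C | forall k, `|set_val (H w) 0 k - set_val r 0 k| < e]).
  apply: Hw; apply/nbhs_ballP; exists e => // r [_ wr] k; exact: wr.
move=> /nbhs_orthantP[d d0 dH]; exists j => k.
have v0 l : 0 <= (if l == j then d / 2 else 0) :> R.
  by case: eqP => // _; rewrite divr_ge0// ltW.
pose w' := raise w v0.
have /dH/(_ k) : forall i k, `|omx w i k - omx w' i k| < d.
  move=> i k'; rewrite (ord1 i) raiseE opprD addNKr normrN ger0_norm//.
  by case: eqP => // _; lra.
rewrite /=; congr (`|_ - _| < _).
have wE : omx w' 0 j = omx w 0 j + d / 2 by rewrite raiseE eqxx.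
have wE' k' : k' != j -> omx w' 0 k' = omx w 0 k'.
  by move=> /negbTE kj; rewrite raiseE kj addr0.
have lt_w k' : k' != j -> C k' * omx w' 0 k' < C j * omx w' 0 j.
  move=> kj; rewrite wE wE'// mulrDr (le_lt_trans (wj k'))// ltrDl.
  by rewrite mulr_gt0// divr_gt0.
have m0 : 0 < C j * omx w' 0 j.
  by rewrite mulr_gt0// wE ltr_wpDl ?omx_ge0// divr_gt0.
by rewrite (max_weight_vertex C_gt0 H_mw m0 lt_w) mxE.
Qed.

Hypothesis (H_qc : quasi_continuous H).

(** At its continuity points [H] is a limit of vertices, and quasi-continuity
    extends this to all points; there are finitely many vertices. *)
Lemma H_vertex w : exists j, set_val (H w) = \row_k if k == j then C j else 0.
Proof.
have [u [uw Hu cu]] := H_qc w.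
apply: contrapT => /forallNP nv.
pose f j := \sum_k `|set_val (H w) 0 k - (if k == j then C j else 0)|.
have f0 j : 0 < f j.
  rewrite lt_neqAle sumr_ge0// andbT eq_sym; apply/eqP => fj; apply: (nv j).
  apply/rowP => k; rewrite mxE; apply/eqP.
  move/eqP: fj; rewrite psumr_eq0// => /allP/(_ k); rewrite mem_index_enum.
  by move=> /(_ isT)/=; rewrite normr_eq0 subr_eq0.
have [e e0 ef] := finite_lower_bound f0.
pose e' := e / (2 * K%:R).
have K0 : 0 < K%:R :> R by rewrite ltr0n.
have e'0 : 0 < e' by rewrite divr_gt0// mulr_gt0.
have : nbhs (H w) [set r : simplex C | forall k, `|set_val (H w) 0 k - set_val r 0 k| < e'].
  by apply/nbhs_ballP; exists e' => // r [_ wr] k; exact: wr.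
move=> /Hu[n _ /(_ n (leqnn n))]/= Hun.
have [j Hj] := H_near_vertex e'0 (cu n).
have : f j < \sum_(k < K) (2 * e').
  apply: ltr_sum => [|k _]; first by apply/hasP; exists (Ordinal K_gt0); rewrite ?mem_index_enum.
  have := ler_distD (set_val (H (u n)) 0 k) (set_val (H w) 0 k) (if k == j then C j else 0).
  by have := Hun k; have := Hj k; lra.
rewrite sumr_const card_ord (_ : (2 * e') *+ K = e); last first.
  by rewrite -mulr_natr /e'; field; rewrite gt_eqF.
by rewrite ltNge ef.
Qed.

(** Quasi-continuity of a service step in the directions of the orthant.  In the
    box no raise is needed, as the projection is continuous.  Outside, all queues
    are raised, to stay outside the box, and the queue [j] selected by [H] more
    than the others: by [t * (1 + S / C j)] against [t], so that its weight grows
    by at least [t * C j] more than any other. *)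
Lemma leftover_quasi_up w e : 0 < e ->
  exists2 v : 'I_K -> R, (forall k, 0 <= v k < e) & exists2 d, 0 < d &
    forall w', (forall k, `|omx w' 0 k - (omx w 0 k + v k)| < d) ->
    forall k, `|leftover Hwc w' k - leftover Hwc w k| < e.
Proof.
move=> e0; pose S := \sum_k C k.
have CS k : C k <= S.
  by rewrite /S (bigD1 k)//= lerDl sumr_ge0// => i _; exact: ltW.
have S0 : 0 < S by exact: lt_le_trans (CS (Ordinal K_gt0)).
have [wb|wb] := pselect (in_box C w).
  exists (fun=> 0); first by move=> k; rewrite lexx.
  have [d1 d10 Hd1] := @finite_lower_bound R K (fun k => C k - omx w 0 k)
    (fun k => etrans (subr_gt0 _ _) (wb k)).
  pose d2 := (e / 2) ^+ 2 / S.
  have d20 : 0 < d2 by rewrite divr_gt0// exprn_gt0// divr_gt0.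
  exists (Num.min d1 (Num.min d2 (e / 2))); first by rewrite !lt_min d10 d20 divr_gt0.
  move=> w' Hw'; have w'w k : [/\ `|omx w' 0 k - omx w 0 k| < d1,
      `|omx w' 0 k - omx w 0 k| < d2 & `|omx w' 0 k - omx w 0 k| < e / 2].
    by have := Hw' k; rewrite addr0 !lt_min => /and3P[].
  have wb' : in_box C w'.
    move=> k; have [h1 _ _] := w'w k; have := Hd1 k.
    by move: h1; rewrite ltr_norml => /andP[_]; lra.
  set p := set_val (Hwc w); set p' := set_val (Hwc w').
  have ps := Hwc_simplex Hwc w; have ps' := Hwc_simplex Hwc w'.
  have V := euclid_proj_variational (box_proj Hwc_wc wb) ps'.
  have V' := euclid_proj_variational (box_proj Hwc_wc wb') ps.
  rewrite -/p -/p' in V V' ps ps'.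
  have simplex_le (q : 'rV[R]_K) k : simplex C q -> 0 <= q 0 k <= C k.
    move=> [q0 q1]; rewrite q0/= -[leRHS]mul1r -ler_pdivrMr//.
    apply: le_trans q1; rewrite (bigD1 k)//= lerDl sumr_ge0// => i _.
    by rewrite divr_ge0//; exact: ltW.
  have pp : \sum_k (p' 0 k - p 0 k) ^+ 2 <= d2 * S.
    (* Adding the two variational inequalities bounds the distance of the
       projections. *)
    have : \sum_k (p' 0 k - p 0 k) ^+ 2 <=
        \sum_k (omx w' 0 k - omx w 0 k) * (p' 0 k - p 0 k).
      rewrite -subr_le0 -sumrB; apply: le_trans (_ : _ <= 0 + 0) _; last by rewrite addr0.
      apply: le_trans (lerD V V'); rewrite -big_split/= le_eqVlt; apply/orP; left.
      by apply/eqP/eq_bigr => k _; ring.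
    move=> /le_trans; apply; rewrite /S mulr_sumr; apply: ler_sum => k _.
    apply: le_trans (ler_norm _) _; rewrite normrM ler_pM//.
      by have [_ /ltW + _] := w'w k.
    have := simplex_le _ k ps; have := simplex_le _ k ps'.
    by move=> /andP[? ?] /andP[? ?]; rewrite ler_norml; apply/andP; split; lra.
  have pk k : `|p' 0 k - p 0 k| <= e / 2.
    have : (p' 0 k - p 0 k) ^+ 2 <= (e / 2) ^+ 2.
      rewrite (_ : (e / 2) ^+ 2 = d2 * S); last by rewrite divfK// gt_eqF.
      apply: le_trans pp; rewrite (bigD1 k)//= lerDl sumr_ge0// => i _.
      exact: sqr_ge0.
    by rewrite -real_normK ?num_real// ler_sqr// nnegrE// divr_ge0// ltW.
  move=> k; rewrite /leftover; apply: le_lt_trans (max0_lipschitz _ _) _.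
  rewrite -/p -/p' (_ : _ - _ = (omx w' 0 k - omx w 0 k) - (p' 0 k - p 0 k)); last by ring.
  have [_ _ h3] := w'w k; have := pk k.
  have := ler_normB (omx w' 0 k - omx w 0 k) (p' 0 k - p 0 k); lra.
have [j Hj] := H_vertex w.
have [[i wi] HwE] := out_of_box Hwc_wc wb.
have wj k : C k * omx w 0 k <= C j * omx w 0 j.
  have := H_mw w (simplex_vertex C_gt0 k); rewrite Hj /inner.
  rewrite (bigD1 k)//= mxE eqxx big1 => [|l lk]; last by rewrite mxE (negbTE lk) mul0r.
  rewrite (bigD1 j)//= mxE eqxx big1 => [|l lj]; last by rewrite mxE (negbTE lj) mul0r.
  by rewrite !addr0.
pose t := e / (2 * (1 + S / C j)).
have SC0 : 0 < S / C j by rewrite divr_gt0.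
have t0 : 0 < t by rewrite divr_gt0// mulr_gt0// addr_gt0.
have tE : t * (1 + S / C j) = e / 2.
  by rewrite /t; field; rewrite !gt_eqF// addr_gt0.
have t_le : t <= e / 2 by rewrite -tE mulrDr mulr1 lerDl mulr_ge0// ltW.
exists (fun k => t * (1 + (if k == j then S / C j else 0))).
  by move=> k; case: eqP => _; rewrite ?addr0 ?mulr1 ?tE; apply/andP; split; lra.
pose d := Num.min (t / 2) (t * C j / (4 * S)).
have d0 : 0 < d by rewrite lt_min; apply/andP; split; apply: divr_gt0 => //; exact: mulr_gt0.
have dt : d <= t / 2 by rewrite ge_min lexx.
have dS : d * S <= t * C j / 4.
  apply: (@le_trans _ _ (t * C j / (4 * S) * S)).
    by rewrite ler_pM2r// ge_min lexx orbT.
  by rewrite (_ : t * C j / (4 * S) * S = t * C j / 4)//; field; rewrite gt_eqF.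
exists d => // w' Hw'.
have wb' : ~ in_box C w'.
  move=> /(_ i); have := Hw' i; rewrite ltr_norml => /andP[+ _].
  have : t <= t * (1 + (if i == j then S / C j else 0)).
    apply: ler_peMr; first exact: ltW.
    by rewrite lerDl; case: eqP => // _; exact: ltW.
  by lra.
have lt_w k : k != j -> C k * omx w' 0 k < C j * omx w' 0 j.
  move=> kj; have := Hw' k; have := Hw' j; rewrite (negbTE kj) eqxx addr0 mulr1 !ltr_norml.
  move=> /andP[h1 _] /andP[_ h2].
  have h3 : C k * omx w' 0 k < C k * (omx w 0 k + t + d).
    by rewrite ltr_pM2l//; lra.
  have h5 : C j * (t * (1 + S / C j)) = t * C j + t * S by field; rewrite gt_eqF.
  have h4 : C j * omx w 0 j + (t * C j + t * S) - C j * d < C j * omx w' 0 j.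
    by rewrite -h5 -mulrDr -mulrBr ltr_pM2l//; lra.
  have h6 : C k * t <= t * S by rewrite mulrC ler_pM2l.
  have h7 : C k * d <= d * S by rewrite mulrC ler_pM2l.
  have h8 : C j * d <= d * S by rewrite mulrC ler_pM2l.
  have h9 : 0 < t * C j by rewrite mulr_gt0.
  by have := wj k; move: h3 h4; rewrite !mulrDr; lra.
move=> k; rewrite /leftover (leftover_max C_gt0 H_mw Hwc_wc wb' lt_w) HwE Hj.
apply: le_lt_trans (max0_lipschitz _ _) _.
set q := (\row__ _) 0 k; rewrite (_ : _ - _ = omx w' 0 k - omx w 0 k); last by ring.
have := Hw' k; set v := t * _ => h.
have v0 : 0 <= v <= e / 2.
  rewrite /v; case: eqP => _; first by rewrite tE lexx divr_ge0// ltW.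
  by rewrite addr0 mulr1 t_le ltW.
have := ler_normD (omx w' 0 k - (omx w 0 k + v)) v.
rewrite (ger0_norm (proj1 (andP v0))) (_ : _ + v = omx w' 0 k - omx w 0 k); last by ring.
by move: v0 h => /andP[_ +]; lra.
Qed.

(** The raise needed before a service step is added to the arrivals just before
    it; the raises of earlier arrivals are then taken so small that they do not
    leave the open set obtained at this step.  The induction therefore concerns the
    leftover, to which the last arrivals are not yet added. *)
Lemma run_quasi (a : nat -> orthant R 1 K) T e : 0 < e ->
  exists a' : nat -> orthant R 1 K, exists d,
  [/\ 0 < d, forall s k, `|omx (a' s) 0 k - omx (a s) 0 k| < e &
    forall b : nat -> orthant R 1 K,
      (forall s k, (s < T)%N -> `|omx (b s) 0 k - omx (a' s) 0 k| < d) ->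
      forall k, `|omx (run Hwc b T) 0 k - omx (run Hwc a T) 0 k| < e].
Proof.
have leftoverP n : forall (a : nat -> orthant R 1 K) e, 0 < e ->
    exists a' : nat -> orthant R 1 K, exists d,
    [/\ 0 < d, forall s k, `|omx (a' s) 0 k - omx (a s) 0 k| < e &
    forall b : nat -> orthant R 1 K,
      (forall s k, (s < n)%N -> `|omx (b s) 0 k - omx (a' s) 0 k| < d) ->
      forall k, `|leftover Hwc (run Hwc b n) k - leftover Hwc (run Hwc a n) k| < e].
  elim: n => [|n IH] {}a {}e e0.
    exists a, 1; split=> // [s k|b _ k]; by rewrite subrr normr0.
  have [v v0 [d1 d10 Hd1]] := leftover_quasi_up (run Hwc a n.+1) e0.
  have vge0 k : 0 <= v k by have /andP[] := v0 k.
  have m0 : 0 < Num.min e (d1 / 2) by rewrite lt_min e0 divr_gt0.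
  have [a' [d2 [d20 a'a Ha']]] := IH (past 1 a) _ m0.
  exists (fun s => if s is s'.+1 then a' s' else raise (a 0%N) vge0).
  exists (Num.min d2 (d1 / 2)); split; first by rewrite lt_min d20 divr_gt0.
    move=> [|s] k; first by rewrite raiseE addrC addKr ger0_norm//; have /andP[] := v0 k.
    by have := a'a s k; rewrite lt_min => /andP[].
  move=> b Hb; apply: Hd1 => k; rewrite !runSE.
  have := Ha' (past 1 b) _ k; rewrite lt_min => /(_ _)/andP[|_ h1].
    by move=> s k' sn; have := Hb s.+1 k' sn; rewrite lt_min => /andP[].
  have := Hb 0%N k isT; rewrite lt_min raiseE => /andP[_ h2].
  rewrite (_ : _ - _ = (leftover Hwc (run Hwc (past 1 b) n) k - leftover Hwc (run Hwc (past 1 a) n) k)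
    + (omx (b 0%N) 0 k - (omx (a 0%N) 0 k + v k))); last by ring.
  by apply: le_lt_trans (ler_normD _ _) _; lra.
case: T => [|T] e0.
  exists a, 1; split=> // [s k|b _ k]; by rewrite subrr normr0.
have e20 : 0 < e / 2 by rewrite divr_gt0.
have [a' [d [d0 a'a Ha']]] := leftoverP T (past 1 a) _ e20.
exists (fun s => if s is s'.+1 then a' s' else a 0%N), (Num.min d (e / 2)).
split; first by rewrite lt_min d0.
  move=> [|s] k; first by rewrite subrr normr0.
  by apply: lt_le_trans (a'a s k) _; lra.
move=> b Hb k; rewrite !runSE.
have h1 : `|leftover Hwc (run Hwc (past 1 b) T) k - leftover Hwc (run Hwc (past 1 a) T) k| < e / 2.
  by apply: Ha' => s k' sT; have := Hb s.+1 k' sT; rewrite lt_min => /andP[].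
have := Hb 0%N k isT; rewrite lt_min => /andP[_ h2].
rewrite (_ : _ - _ = (leftover Hwc (run Hwc (past 1 b) T) k - leftover Hwc (run Hwc (past 1 a) T) k)
    + (omx (b 0%N) 0 k - omx (a 0%N) 0 k)); last by ring.
by apply: le_lt_trans (ler_normD _ _) _; lra.
Qed.

End quasi.

(** * Limits of the workload below the critical load *)

Lemma cvg_inv_nat (R : realType) : (t%:R^-1 : R) @[t --> \oo] --> 0.
Proof. by rewrite -cvg_shiftS; exact: cvg_harmonic. Qed.

Section splice.
Context {R : realType} {K : nat} {mu : 'rV[R]_K}.
Implicit Types a x : arrivals mu.

Lemma arrivals_splice a T (g : nat -> orthant R 1 K) :
  exists x : arrivals mu, forall k s,
    arrival x k s = if (s < T)%N then omx (g s) 0 k else arrival a k s.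
Proof.
apply: (@arrivals_of_mean R K mu (fun s k => if (s < T)%N then omx (g s) 0 k else arrival a k s)).
  by move=> s k; case: ifP => _; [exact: omx_ge0|exact: path_ge0].
move=> k; pose f s := if (s < T)%N then omx (g s) 0 k else arrival a k s.
change ((fun t => cumul f t / t%:R) @ \oo --> mu 0 k).
pose D := cumul f T - cumul (arrival a k) T.
have fE t : (T <= t)%N -> cumul f t = cumul (arrival a k) t + D.
  move=> /subnKC <-; rewrite /D /cumul !big_split_ord/=.
  rewrite [X in _ + X = _](eq_bigr (fun i : 'I_(t - T) => arrival a k (T + i)%N)).
    by ring.
  by move=> i _; rewrite /f/= ltnNge leq_addr.
apply: (@cvg_trans _ ((fun t => cumul (arrival a k) t / t%:R + D * t%:R^-1) @ \oo)).
  apply: near_eq_cvg; exists T => // t /= Tt.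
  by rewrite fE// [RHS]mulrDl.
rewrite -[mu 0 k]addr0; apply: cvgD; first exact: (set_valP (a k)).
rewrite -(mulr0 D); apply: cvgM; first exact: cvg_cst.
exact: cvg_inv_nat.
Qed.

(** A modification inside a window changes all partial sums by at most the
    total change inside the window. *)
Lemma splice_ball a x T e :
  (forall k s, (T <= s)%N -> arrival x k s = arrival a k s) ->
  (forall k, \sum_(s < T) `|arrival a k s - arrival x k s| < e) ->
  arrivals_ball a e x.
Proof.
move=> ax axe k; apply: le_lt_trans (axe k); apply: path_dist_le => t t0.
rewrite -/(arrival a k) -/(arrival x k).
rewrite normrM (@ger0_norm _ t%:R^-1)// ler_pdivrMr ?ltr0n//.
set S := \sum_(s < T) _.
have S0 : 0 <= S by exact: sumr_ge0.
apply: (@le_trans _ _ S); last by rewrite ler_peMr// ler1n.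
rewrite -cumulB (le_trans (ler_norm_sum _ _ _))//.
have [tT|Tt] := leqP t T.
  rewrite /S -(subnKC tT) big_split_ord/= lerDl; exact: sumr_ge0.
rewrite -(subnKC (ltnW Tt)) big_split_ord/= [X in _ + X]big1 ?addr0// => i _.
have E : set_val (x k) (T + i)%N = set_val (a k) (T + i)%N by exact: ax (leq_addr _ _).
by rewrite /= E subrr normr0.
Qed.

End splice.

Section stable.
Context {R : realType} {K : nat} {mu : 'rV[R]_K} (C : 'I_K -> R).
Context (H Hwc : orthant R 1 K -> simplex C).
Implicit Types a x : arrivals mu.
Hypotheses (C_gt0 : forall k, 0 < C k) (K_gt0 : (0 < K)%N).
Hypotheses (H_mw : max_weight H) (Hwc_wc : work_conserving H Hwc).
Hypothesis (H_qc : quasi_continuous H).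
Context (c : R).
Hypotheses (c_gt0 : 0 < c) (c_le : forall k, c <= C k).
Hypothesis mu_lt : cost C (mu 0) < c ^+ 2.
Let G : arrivals mu -> orthant R 1 K := @workload_infty R K C Hwc mu.
Let local := workload_infty_local C_gt0 H_mw Hwc_wc c_gt0 c_le mu_lt.

Lemma workload_infty_bounded x : exists2 U, nbhs x U &
  exists2 B : set (orthant R 1 K), compact B & G @` U `<=` B.
Proof.
have [e e0 [T1 _ HT1]] := local x.
exists (arrivals_ball x e); first exact: nbhs_arrivals_ball.
exists [set b : orthant R 1 K | forall k, omx b 0 k <=
    \sum_i cumul (arrival x i) T1 + e * T1%:R]; first exact: box_compact.
move=> _ [z xz <-] k; rewrite /G HT1//.
apply: (le_trans (run_le _ _ _ _)).
rewrite (eq_bigr (fun s : 'I_T1 => arrival z k s)) => [|s _]; last exact: sliceE.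
have := cumul_dist k T1 xz; rewrite ler_norml => /andP[+ _].
have : cumul (arrival x k) T1 <= \sum_i cumul (arrival x i) T1.
  rewrite (bigD1 k)//= lerDl sumr_ge0// => i _; apply: sumr_ge0 => s _.
  exact: path_ge0.
by rewrite -[\sum_(s < T1) _]/(cumul (arrival z k) T1); lra.
Qed.

(** Near [x] the workload is the run over a fixed window.  For paths [z n]
    tending to [x] whose workloads tend to [y], take the windows [b n] given by
    [run_quasi] and continue them by the tail of [x].  These paths tend to [x] and
    equal [x] beyond the window, so the values of [I] converge to [I x]; the
    workload is close to [y] on a neighbourhood of each. *)
Lemma workload_infty_approximation (I : arrivals mu -> \bar R)
  (I_tail : forall (a : arrivals mu) (u : nat -> arrivals mu),
     (I a < +oo)%E -> u @ \oo --> a ->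
     (exists2 t : nat, (0 < t)%N &
        forall n k s, (t <= s)%N -> arrival (u n) k s = arrival a k s) ->
     I (u n) @[n --> \oo] --> I a) x y U (r : \bar R) :
  (I x < r)%E -> cluster_set G x y -> nbhs y U ->
  exists2 x', (I x' < r)%E & nbhs x' (G @^-1` U).
Proof.
move=> Ixr xy /nbhs_orthantP[e e0 eU].
have [f f0 [T T_gt0 HT]] := local x.
pose h n := Num.min f n.+1%:R^-1 : R.
have h0 n : 0 < h n by rewrite lt_min f0 invr_gt0 ltr0n.
have e20 : 0 < e / 2 by rewrite divr_gt0.
have /choice[z Hz] n : exists z, arrivals_ball x (h n) z /\
    forall k, `|omx y 0 k - omx (G z) 0 k| < e / 2.
  have := (iffLR (cluster_setP G y (arrivals_nbhs_sequence x)) xy)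
    (arrivals_ball x (h n)) [set b | forall k, `|omx y 0 k - omx b 0 k| < e / 2].
  case.
  - exact: nbhs_arrivals_ball.
  - by apply/nbhs_orthantP; exists (e / 2) => // b yb k; exact: yb.
  by move=> z xz yz; exists z.
have m0 n : 0 < Num.min (e / 2) n.+1%:R^-1 :> R by rewrite lt_min e20 invr_gt0 ltr0n.
have /choice[b Hb] n := run_quasi C_gt0 H_mw Hwc_wc K_gt0 H_qc (slice (z n)) T (m0 n).
have /choice[u Hu] n := arrivals_splice x T (b n).
have ux : u @ \oo --> x.
  move=> A /nbhs_arrivalsP[g g0 gA].
  pose N := Num.bound (2 * T%:R * (T%:R + 1) / g : R).
  have HN : 2 * T%:R * (T%:R + 1) < g * N%:R.
    rewrite -ltr_pdivrMl// mulrC; apply: archi_boundP; apply: divr_ge0; last exact: ltW.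
    by apply: mulr_ge0; [exact: mulr_ge0|exact: addr_ge0].
  exists N => // n /= Nn; apply: gA; apply: (@splice_ball _ _ _ _ _ T).
    by move=> k s Ts; rewrite Hu ltnNge Ts.
  move=> k; apply: (@le_lt_trans _ _ (\sum_(s < T) 2 * (T%:R + 1) * n.+1%:R^-1)).
    apply: ler_sum => s _; rewrite Hu ltn_ord.
    have [xz _] := Hz n; have [d [_ bz _]] := Hb n.
    have h1 : `|arrival x k s - arrival (z n) k s| <= n.+1%:R^-1 * (s.*2.+1)%:R.
      apply: le_trans (arrival_dist k s xz) _.
      by rewrite ler_wpM2r// /h ge_min lexx orbT.
    have h2 : `|omx (b n s) 0 k - arrival (z n) k s| < n.+1%:R^-1.
      by have := bz s k; rewrite sliceE lt_min => /andP[].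
    have h3 : n.+1%:R^-1 * (s.*2.+1)%:R <= n.+1%:R^-1 * (2 * T%:R + 1) :> R.
      rewrite ler_pM2l ?invr_gt0 ?ltr0n// -natrM -natr1 lerD2r ler_nat -mul2n.
      by rewrite leq_mul2l ltnW.
    have := ler_distD (arrival (z n) k s) (arrival x k s) (omx (b n s) 0 k).
    rewrite (distrC (arrival (z n) k s)) => h4.
    rewrite (le_trans h4)// (le_trans (lerD (le_trans h1 h3) (ltW h2)))//.
    by rewrite le_eqVlt; apply/orP; left; apply/eqP; ring.
  rewrite sumr_const card_ord -[_ *+ T]mulr_natr mulrAC ltr_pdivrMr ?ltr0n//.
  rewrite (_ : 2 * (T%:R + 1) * T%:R = 2 * T%:R * (T%:R + 1)); last by ring.
  by rewrite (lt_le_trans HN)// ler_pM2l// ler_nat ltnW.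
have Iu : I (u n) @[n --> \oo] --> I x.
  apply: I_tail => //; first by rewrite (lt_le_trans Ixr)// leey.
  by exists T => // n k s Ts; rewrite Hu ltnNge Ts.
have : \forall n \near \oo, (I (u n) < r)%E /\ (arrivals_ball x f)° (u n).
  apply: filterI.
    apply: (Iu [set t | (t < r)%E]); apply: open_nbhs_nbhs; split => //.
    exact: open_ereal_lt_ereal.
  by apply: ux; apply: nbhs_interior; exact: nbhs_arrivals_ball.
case=> n _ /(_ n (leqnn n))[Iun xun]; exists (u n) => //.
have [d [d0 bz Hd]] := Hb n.
pose d' := d / (T.*2.+1)%:R.
have d'0 : 0 < d' by rewrite divr_gt0// ltr0n.
apply: filterS (filterI xun (nbhs_arrivals_ball (u n) d'0)) => x' [xx' ux'].
apply: eU => i k; rewrite (ord1 i) /G HT//.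
have [xz yz] := Hz n.
have zf : arrivals_ball x f (z n).
  by move=> l; apply: lt_le_trans (xz l) _; rewrite ge_min lexx.
have := yz k; rewrite /G (HT _ zf).
have : `|omx (run Hwc (slice x') T) 0 k - omx (run Hwc (slice (z n)) T) 0 k| < e / 2.
  have : `|omx (run Hwc (slice x') T) 0 k - omx (run Hwc (slice (z n)) T) 0 k| <
     Num.min (e / 2) n.+1%:R^-1.
    apply: Hd => s l sT; rewrite sliceE.
    have := arrival_dist l s ux'; rewrite Hu sT distrC => /le_lt_trans; apply.
    rewrite /d' mulrAC ltr_pdivrMr ?ltr0n// ltr_pM2l// ltr_nat ltnS.
    by rewrite ltn_double.
  by rewrite lt_min => /andP[].
rewrite distrC.
have := ler_distD (omx (run Hwc (slice (z n)) T) 0 k) (omx y 0 k) (omx (run Hwc (slice x') T) 0 k).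
lra.
Qed.

End stable.

(** * Service steps that preserve or swap a residual workload *)

Section memory.
Context {R : realType} {K : nat} (C : 'I_K -> R) (H Hwc : orthant R 1 K -> simplex C).
Hypotheses (C_gt0 : forall k, 0 < C k).
Hypotheses (H_mw : max_weight H) (Hwc_wc : work_conserving H Hwc).

(** The step relation of the leftovers: leftover [x] before the arrivals [z],
    leftover [y] after the next service. *)
Definition after (x z y : 'I_K -> R) := forall w : orthant R 1 K,
  (forall k, omx w 0 k = x k + z k) -> forall k, leftover Hwc w k = y k.

Lemma after_max j (x z y : 'I_K -> R) :
  (exists k, C k <= x k + z k) ->
  (forall k, k != j -> C k * (x k + z k) < C j * (x j + z j)) ->
  (forall k, k != j -> y k = x k + z k) ->
  y j = Num.max 0 (x j + z j - C j) ->
  after x z y.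
Proof.
move=> [i xi] xj yk yj w wE k.
rewrite (leftover_maxE C_gt0 H_mw Hwc_wc (j := j)).
- by case: eqP => [->|/eqP kj]; rewrite wE ?yj// yk.
- by move=> /(_ i); rewrite wE ltNge xi.
- by move=> l lj; rewrite !wE; exact: xj.
Qed.

Lemma after_simplex (x z : 'I_K -> R) :
  \sum_k (x k + z k) / C k <= 1 -> after x z (fun=> 0).
Proof.
move=> xz w wE k; apply: (leftover_simplex C_gt0 H_mw Hwc_wc); split.
  by move=> i; exact: omx_ge0.
by under eq_bigr do rewrite wE.
Qed.

Context (k0 j0 : 'I_K).
Let c := C k0.
Let m := C j0.
Hypothesis (cm : c < m).

Definition unit_at (j : 'I_K) (b : R) (k : 'I_K) : R := if k == j then b else 0.

(** The small part of a residual.  The queues other than [k0] that have the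
    smallest rate hold more than [k0] does in excess of [c]: a batch [c] arriving
    at one of them then wins against [k0]. *)
Definition margin (e : R) (k : 'I_K) : R :=
  if k == k0 then e else if C k == c then 2 * e else 0.

(** The residual that survives: [k0] holds slightly more than its rate, which
    keeps the workload out of the box. *)
Definition level (e : R) (k : 'I_K) : R := unit_at k0 c k + margin e k.

Let c_gt0 : 0 < c := C_gt0 k0.
Let m_gt0 : 0 < m := C_gt0 j0.
Let j0k0 : j0 != k0.
Proof. by apply/eqP => jk; move: cm; rewrite /m jk ltxx. Qed.
Let Cj0 : (C j0 == c) = false.
Proof. by rewrite gt_eqF. Qed.

Lemma after_batch0 j b : 0 <= b <= C j -> after (fun=> 0) (unit_at j b) (fun=> 0).
Proof.
move=> /andP[b0 bC]; apply: after_simplex; rewrite (bigD1 j)//= big1 => [|k kj].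
  by rewrite /unit_at eqxx add0r addr0 ler_pdivrMr// mul1r.
by rewrite /unit_at (negbTE kj) addr0 mul0r.
Qed.

(** A batch whose weight exceeds that of the residual is served entirely, even
    if it is smaller than [C j], and the residual is untouched. *)
Lemma after_batch_large e j b : 0 < e -> 2 * e <= c -> c < C j ->
  b <= C j -> c * (c + e) < C j * b ->
  after (level e) (unit_at j b) (level e).
Proof.
have hc := c_gt0; move=> e0 ec cCj bC cb.
have jk : (j == k0) = false by apply/eqP => jk; move: cCj; rewrite jk ltxx.
have Cj : (C j == c) = false by rewrite gt_eqF.
have lj : level e j = 0 by rewrite /level /unit_at /margin jk Cj addr0.
apply: (@after_max j).
- exists k0; rewrite /level /margin /unit_at eqxx (eq_sym k0) jk addr0 lerDl.
  exact: ltW.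
- move=> k kj; rewrite lj add0r /level /unit_at (negbTE kj) eqxx addr0 /margin.
  case: eqP => [->//|_]; case: eqP => [->|_]; rewrite add0r ?mulr0.
    by apply: le_lt_trans cb; rewrite ler_pM2l//; lra.
  by apply: lt_trans cb; rewrite mulr_gt0// addr_gt0.
- by move=> k kj; rewrite /unit_at (negbTE kj) addr0.
- by rewrite lj add0r /unit_at eqxx max_l// subr_le0.
Qed.

(** The queues of smallest rate cannot absorb a batch larger than [c]; here the
    batch is exactly [c], and the margin makes the queue win. *)
Lemma after_batch_small e j : 0 < e -> 2 * e <= c -> C j = c ->
  after (level e) (unit_at j c) (level e).
Proof.
have hc := c_gt0; move=> e0 ec Cj.
have lj : 0 <= level e j.
  rewrite /level /unit_at /margin Cj eqxx.
  by case: eqP => _; lra.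
apply: (@after_max j).
- by exists j; rewrite Cj /unit_at eqxx lerDr.
- move=> k kj; rewrite /level /unit_at (negbTE kj) eqxx addr0 /margin Cj eqxx.
  have [kk|kk] := eqVneq k k0.
    rewrite kk -/c; have -> : (j == k0) = false by rewrite eq_sym -kk (negbTE kj).
    by rewrite ltr_pM2l//; lra.
  case: eqP => [->|_].
    by rewrite ltr_pM2l//; case: eqP => _; lra.
  by rewrite addr0 mulr0 mulr_gt0//; case: eqP => _; lra.
- by move=> k kj; rewrite /unit_at (negbTE kj) addr0.
- by rewrite /unit_at eqxx Cj addrK max_r.
Qed.

Context (e e' v : R) (N : nat).
Let E := e + e'.
Let b := m - v / N%:R.
Hypotheses (e_gt0 : 0 < e) (e'_gt0 : 0 < e') (E_le : 2 * E <= c) (N_gt0 : (0 < N)%N).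
Hypotheses (v_gt : c * (c + e) < m * v) (v_lt : m * v < c * (c + E)).
Hypotheses (b_gt : c * (c + E) < m * b).
Hypothesis (E_small : v / m + (2 * E / c) * K%:R <= 1).

(** The doubled residual after one service of [k0], with work [r] at [j0]. *)
Definition high (r : R) (k : 'I_K) : R := level E k + unit_at j0 r k.
(** What remains once [k0] has been served twice, with work [r] at [j0]; queue
    [k0] now holds less than its rate. *)
Definition low (r : R) (k : 'I_K) : R := margin E k + unit_at j0 r k.

Let v_gt0 : 0 < v.
Proof. by rewrite -(pmulr_rgt0 _ m_gt0) (lt_trans _ v_gt)// mulr_gt0// addr_gt0. Qed.

Let Nr_gt0 : 0 < N%:R :> R. Proof. by rewrite ltr0n. Qed.

Let b_le : b <= m.
Proof. by rewrite /b lerBlDr lerDl divr_ge0// ltW. Qed.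

Lemma v_le : v <= m.
Proof.
rewrite -(ler_pM2l m_gt0) (le_trans (ltW v_lt))// (le_trans (ltW b_gt))//.
by rewrite ler_pM2l.
Qed.

(** The exchange starts with a new residual and a batch [v] at [j0].  Without a
    previous residual the batch wins and the new residual is established. *)
Lemma after_swap_first : after (fun=> 0) (fun k => unit_at j0 v k + level e k) (level e).
Proof.
have [he he' hE hc] : [/\ 0 < e, 0 < e', 2 * (e + e') <= c & 0 < c] by [].
move=> w wE; apply: (@after_batch_large e j0 v _ _ _ _ _ w) => //; last first.
- by move=> k; rewrite wE add0r addrC.
- exact: v_le.
- by rewrite /E; lra.
Qed.

(** With a previous residual, [k0] holds about [2 * c] and wins against the same
    batch, which waits at [j0]. *)
Lemma after_high_start :
  after (level e') (fun k => unit_at j0 v k + level e k) (high v).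
Proof.
have [he he' hE hc] : [/\ 0 < e, 0 < e', 2 * (e + e') <= c & 0 < c] by [].
apply: (@after_max k0); rewrite /high /level /margin /unit_at.
- by exists k0; rewrite eqxx (eq_sym k0) (negbTE j0k0) -/c; lra.
- move=> k kk; rewrite (negbTE kk) eqxx (eq_sym k0) (negbTE j0k0).
  have [->|kj] := eqVneq k j0.
    rewrite Cj0 !add0r !addr0 -/m -/c; apply: lt_trans v_lt _.
    by rewrite ltr_pM2l// /E; lra.
  case: eqP => [->|_]; last first.
    by rewrite !addr0 mulr0 mulr_gt0//; lra.
  by rewrite -/c ltr_pM2l//; rewrite /E; lra.
- move=> k kk; rewrite (negbTE kk) /E; case: ifP => _; case: ifP => _; rewrite /E; lra.
- rewrite eqxx (eq_sym k0) (negbTE j0k0) -/c max_r; rewrite /E; lra.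
Qed.

(** Batches [b] slightly smaller than [C j0] let [j0] catch up by [v / N] at
    each step while it keeps winning. *)
Lemma after_high r : 0 <= r -> m <= r + b ->
  after (high r) (unit_at j0 b) (high (r - v / N%:R)).
Proof.
have [he he' hE hc] : [/\ 0 < e, 0 < e', 2 * (e + e') <= c & 0 < c] by [].
move=> r0 rb; apply: (@after_max j0); rewrite /high /level /margin /unit_at.
- by exists j0; rewrite eqxx (negbTE j0k0) Cj0 -/m; lra.
- move=> k kj; rewrite (negbTE kj) eqxx (negbTE j0k0) Cj0 !add0r !addr0 -/m.
  have bE : m * b <= m * (r + b) by rewrite ler_pM2l// lerDr.
  apply: lt_le_trans bE; apply: le_lt_trans b_gt.
  case: eqP => [->|_] //.
  case: eqP => [->|_]; rewrite add0r; first by rewrite ler_pM2l// /E; lra.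
  by rewrite mulr0 mulr_ge0// ?addr_ge0// ltW// addr_gt0.
- by move=> k kj; rewrite (negbTE kj) !addr0.
- rewrite eqxx (negbTE j0k0) Cj0 -/m !add0r max_r; move: rb; rewrite /b; lra.
Qed.

(** The batch [v] lies between the weights of the single and of the doubled
    residual, and distinguishes them: here [k0] wins again. *)
Lemma after_test : after (high 0) (unit_at j0 v) (low v).
Proof.
have [he he' hE hc] : [/\ 0 < e, 0 < e', 2 * (e + e') <= c & 0 < c] by [].
apply: (@after_max k0); rewrite /high /low /level /margin /unit_at.
- by exists k0; rewrite eqxx (eq_sym k0) (negbTE j0k0) -/c /E; lra.
- move=> k kk; rewrite (negbTE kk) eqxx (eq_sym k0) (negbTE j0k0) !addr0.
  have [->|kj] := eqVneq k j0.
    by rewrite Cj0 !add0r -/m -/c.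
  rewrite !addr0 !add0r; case: eqP => [->|_].
    by rewrite -/c ltr_pM2l// /E; lra.
  by rewrite mulr0 mulr_gt0// /E; lra.
- by move=> k kk; rewrite (negbTE kk); case: ifP => _; case: ifP => _; rewrite /E; lra.
- rewrite eqxx (eq_sym k0) (negbTE j0k0) -/c max_r; rewrite /E; lra.
Qed.

(** Queue [k0] holds less than [c] by now, but [j0] holds at least its rate,
    so that the workload stays outside the box and [j0] is served at full rate. *)
Lemma after_low r : 0 <= r -> m <= r + b ->
  after (low r) (unit_at j0 b) (low (r - v / N%:R)).
Proof.
have [he he' hE hc] : [/\ 0 < e, 0 < e', 2 * (e + e') <= c & 0 < c] by [].
move=> r0 rb; apply: (@after_max j0); rewrite /low /margin /unit_at.
- by exists j0; rewrite eqxx (negbTE j0k0) Cj0 -/m; lra.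
- move=> k kj; rewrite (negbTE kj) eqxx (negbTE j0k0) Cj0 !add0r !addr0 -/m.
  have mm : c * c < m * (r + b).
    by apply: lt_le_trans (_ : m * m <= _); rewrite ?ler_pM2l// ltr_pM// ltW.
  apply: le_lt_trans mm.
  case: eqP => [->|_]; first by rewrite ler_pM2l//; rewrite /E; lra.
  case: eqP => [->|_]; first by rewrite ler_pM2l.
  by rewrite mulr0 mulr_ge0// ltW.
- by move=> k kj; rewrite (negbTE kj) !addr0.
- rewrite eqxx (negbTE j0k0) Cj0 -/m !add0r max_r; move: rb; rewrite /b; lra.
Qed.

(** With [j0] drained, all that remains lies in the simplex together with the
    last batch, and is emptied. *)
Lemma after_low_end : after (low 0) (unit_at j0 v) (fun=> 0).
Proof.
have [he he' hE hc] : [/\ 0 < e, 0 < e', 2 * (e + e') <= c & 0 < c] by [].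
apply: after_simplex; apply: le_trans E_small.
rewrite (_ : v / m = \sum_k unit_at j0 v k / C k); last first.
  rewrite (bigD1 j0)//= /unit_at eqxx big1 ?addr0// => k kj.
  by rewrite (negbTE kj) mul0r.
rewrite (_ : 2 * E / c * K%:R = \sum_(k < K) 2 * E / c); last first.
  by rewrite sumr_const card_ord mulr_natr.
rewrite -big_split/=; apply: ler_sum => k _.
rewrite /low /margin {1}/unit_at if_same addr0 mulrDl [leLHS]addrC lerD2l.
have Ec : 0 <= E / c by rewrite divr_ge0 ?ltW// addr_gt0.
case: eqP => [->|_]; first by rewrite -/c -mulrA; lra.
by case: eqP => [->|_]; rewrite ?mul0r -?mulrA// mulr_ge0.
Qed.

End memory.

(** * Sparse events and prescribed frequencies *)

Section schedule.
Context {R : realType} {K : nat}.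

(** An unbounded counter growing like the square root of time; its ticks
    mark the exceptional blocks, which have density zero. *)
Fixpoint clock (q : nat) : nat :=
  if q is q'.+1 then if ((clock q').+1 ^ 2 <= q')%N then (clock q').+1 else clock q'
  else 0.

Lemma clockS q : clock q.+1 = clock q \/ clock q.+1 = (clock q).+1.
Proof. by rewrite /=; case: ifP; [right|left]. Qed.

Lemma clock_sqr q : (clock q ^ 2 <= q)%N.
Proof. by elim: q => //= q IH; case: ifP => h; apply: leqW. Qed.

Lemma clock_large q : (q <= (clock q).+1 ^ 2)%N.
Proof.
elim: q => //= q IH; case: ifP => h; last by rewrite ltnNge h.
by apply: (leq_ltn_trans IH); rewrite ltn_exp2r.
Qed.

Lemma clock_pinfty M : \forall q \near \oo, (M <= clock q)%N.
Proof.
exists (M ^ 2).+1 => // q /= Mq; have := leq_trans Mq (clock_large q).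
by rewrite ltn_exp2r// ltnS.
Qed.

Lemma clock_ticks n : exists2 q, (n <= q)%N & clock q.+1 = (clock q).+1.
Proof.
apply: contrapT => h.
have cst q : (n <= q)%N -> clock q = clock n.
  move=> /subnKC <-; elim: (q - n)%N => [|i IH]; first by rewrite addn0.
  rewrite addnS; have [->//|E] := clockS (n + i).
  by exfalso; apply: h; exists (n + i)%N => //; exact: leq_addr.
have [q0 _ Hq] := clock_pinfty (clock n).+1.
have := Hq (maxn n q0) (leq_maxr _ _); rewrite cst ?leq_maxl// ltnn.
by [].
Qed.

Lemma clock_le_cvg0 : ((clock t)%:R / t%:R : R) @[t --> \oo] --> 0.
Proof.
apply/cvgr0Pnorm_lt => e e0.
pose M := Num.bound e^-1.
have HM : 1 < e * M%:R by rewrite -ltr_pdivrMl// mulr1 archi_boundP// invr_ge0 ltW.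
have [t0 _ Ht0] := clock_pinfty M.
exists (maxn t0 1) => // t /=; rewrite geq_max => /andP[/Ht0 Mt t1].
have tR : 0 < t%:R :> R by rewrite ltr0n.
rewrite ger0_norm ?divr_ge0// ltr_pdivrMr//.
have : (clock t)%:R * M%:R <= t%:R :> R.
  by rewrite -natrM ler_nat (leq_trans _ (clock_sqr t))// expnS expn1 leq_mul2l Mt orbT.
move=> h; apply: lt_le_trans (_ : e * ((clock t)%:R * M%:R) <= _); last by rewrite ler_pM2l.
rewrite mulrCA ltr_pMr// ltr0n.
have : (0 < M)%N by rewrite -(ltr0n R) -(pmulr_rgt0 _ e0) (lt_trans _ HM).
by move=> M0; exact: leq_trans Mt.
Qed.

Section frequency.
Context (p : 'I_K -> R) (k0 : 'I_K).

(** Greedy scheduling: each step is given to the type that lags most behind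
    its prescribed frequency. *)
Fixpoint tally (t : nat) : 'I_K -> nat :=
  if t is t'.+1 then
    let j := [arg max_(k > k0) (p k * t%:R - (tally t' k)%:R)]%O in
    fun k => (tally t' k + (j == k))%N
  else fun=> 0%N.

Definition next_batch (t : nat) : 'I_K := [arg max_(k > k0) (p k * t.+1%:R - (tally t k)%:R)]%O.

Lemma tallyE t k : (tally t k)%:R = cumul (fun s => (next_batch s == k)%:R : R) t.
Proof.
rewrite /cumul; elim: t => [|t IH]; first by rewrite big_ord0.
by rewrite big_ord_recr/= -IH natrD.
Qed.

Hypotheses (p_ge0 : forall k, 0 <= p k) (p_sum : \sum_k p k = 1).

Lemma tally_sum t : \sum_k (p k * t%:R - (tally t k)%:R) = 0.
Proof.
rewrite sumrB -mulr_suml p_sum mul1r; apply/eqP; rewrite subr_eq0; apply/eqP.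
under eq_bigr do rewrite tallyE /cumul; rewrite exchange_big/=.
rewrite (eq_bigr (fun=> 1)) ?sumr_const ?card_ord// => s _.
by rewrite (bigD1 (next_batch s))//= eqxx big1 ?addr0// => k kp; rewrite eq_sym (negbTE kp).
Qed.

(** The chosen type lags at least as much as the average, so no type gets ahead by more
    than one unit; as the discrepancies have sum 0, they are bounded. *)
Lemma tally_ge t k : -1 <= p k * t%:R - (tally t k)%:R.
Proof.
elim: t k => [|t IH] k; first by rewrite mulr0 subr0 lerN10.
rewrite [tally _ _]/= -/(next_batch t) natrD; have [<-|kp] := eqVneq (next_batch t) k; last first.
  rewrite addr0 (le_trans (IH k))// lerD2r -natr1 mulrDr mulr1 lerDl; exact: p_ge0.
set j := next_batch t; suff : 0 <= p j * t.+1%:R - (tally t j)%:R by rewrite mulr1n; lra.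
have jmax i : p i * t.+1%:R - (tally t i)%:R <= p j * t.+1%:R - (tally t j)%:R.
  by rewrite /j /next_batch; case: Order.TotalTheory.arg_maxP => //= l _; exact.
rewrite leNgt; apply/negP => jlt.
have : \sum_i (p i * t.+1%:R - (tally t i)%:R) <= 0.
  by apply: sumr_le0 => i _; exact: le_trans (jmax i) (ltW jlt).
under eq_bigr do rewrite -natr1 mulrDr mulr1 addrAC.
by rewrite big_split/= tally_sum add0r p_sum ler10.
Qed.

Lemma next_batch_frequency k : (cumul (fun s => (next_batch s == k)%:R : R) t / t%:R) @[t --> \oo] --> p k.
Proof.
have up t : p k * t%:R - (tally t k)%:R <= K%:R.
  have := tally_sum t; rewrite (bigD1 k)//= => /eqP.
  rewrite addr_eq0 => /eqP ->; rewrite -sumrN.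
  apply: (@le_trans _ _ (\sum_(i | i != k) 1)).
    by apply: ler_sum => i _; have := tally_ge t i; lra.
  by rewrite sumr_const -[_ *+ _]/(#|_|%:R) ler_nat (leq_trans (max_card _))// card_ord.
have cst_lim (x : R) : (fun=> x) @ \oo --> x by exact: cvg_cst.
have L : (K%:R * t%:R^-1 : R) @[t --> \oo] --> 0.
  have h := cvgM (cst_lim K%:R) (@cvg_inv_nat R); rewrite mulr0 in h; exact: h.
have K1 : 1 <= K%:R :> R by rewrite ler1n; case: (K) k0 => [[]|].
apply: (@squeeze_cvgr _ _ _ _ (fun t : nat => p k - K%:R * t%:R^-1) (fun t : nat => p k + K%:R * t%:R^-1)).
- exists 1%N => // t /= t1; have tR : 0 < t%:R :> R by rewrite ltr0n.
  rewrite -tallyE ler_pdivlMr// ler_pdivrMr// mulrBl mulrDl divfK ?gt_eqF//.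
  have := up t; have := tally_ge t k; set x := p k * _; set y := _%:R => h1 h2.
  by have [] : x - K%:R <= y /\ y <= x + K%:R by [split; lra]; move=> -> ->.
- have h := cvgB (cst_lim (p k)) L; rewrite subr0 in h; exact: h.
- have h := cvgD (cst_lim (p k)) L; rewrite addr0 in h; exact: h.
Qed.

End frequency.

(** With batches of the full size [C k], the steps needed per unit of time are
    [\sum_k mu k / C k < 1]; with the smallest winning size [c ^+ 2 / C k], they are
    [cost C mu / c ^+ 2 >= 1].  Interpolating linearly the inverse sizes makes the
    required steps exactly one per unit of time. *)
Lemma batch_sizes (C mu : 'I_K -> R) (c : R) :
  (forall k, 0 < C k) -> 0 < c -> (forall k, c <= C k) -> (forall k, 0 <= mu k) ->
  \sum_k mu k / C k < 1 -> c ^+ 2 <= cost C mu ->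
  exists p beta : 'I_K -> R,
  [/\ forall k, 0 <= p k, \sum_k p k = 1, forall k, beta k * p k = mu k,
      forall k, C k = c -> beta k = c &
      forall k, c < C k -> c ^+ 2 <= C k * beta k /\ beta k < C k].
Proof.
move=> C0 c0 cC mu0 rho1 th1.
set rho := \sum_k _ in rho1; pose th := cost C mu / c ^+ 2.
have c20 : 0 < c ^+ 2 by rewrite exprn_gt0.
have th1' : 1 <= th by rewrite ler_pdivlMr// mul1r.
pose tau := (1 - rho) / (th - rho).
have den0 : 0 < th - rho by lra.
have tau0 : 0 < tau by rewrite divr_gt0// subr_gt0.
have tau1 : tau <= 1 by rewrite ler_pdivrMr// mul1r; lra.
pose g k := (1 - tau) / C k + tau * (C k / c ^+ 2).
have g0 k : 0 < g k.
  apply: ltr_wpDl; first by apply: divr_ge0; [rewrite subr_ge0|exact: ltW].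
  by rewrite mulr_gt0// divr_gt0.
have gE k : C k * g k = (1 - tau) + tau * (C k ^+ 2 / c ^+ 2).
  by rewrite /g; field; rewrite !gt_eqF.
exists (fun k => mu k * g k), (fun k => (g k)^-1); split.
- by move=> k; rewrite mulr_ge0// ltW.
- rewrite (eq_bigr (fun k => (1 - tau) * (mu k / C k) + tau / c ^+ 2 * (C k * mu k))).
    rewrite big_split/= -!mulr_sumr -/rho -/(cost C mu).
    rewrite (_ : tau / c ^+ 2 * _ = tau * th); last by rewrite /th; field; rewrite gt_eqF.
    have : tau * (th - rho) = 1 - rho by rewrite /tau divfK// gt_eqF.
    by rewrite mulrBr mulrBl mul1r; lra.
  by move=> k _; rewrite /g; field; rewrite !gt_eqF.
- by move=> k; rewrite mulrC mulfK// gt_eqF.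
- move=> k Ck; apply: (mulIf (lt0r_neq0 (g0 k))); rewrite mulVf ?gt_eqF//.
  by rewrite -{1}Ck gE Ck divff ?gt_eqF// mulr1 subrK.
- move=> k cCk.
  have C2 : 1 < C k ^+ 2 / c ^+ 2 by rewrite ltr_pdivlMr// mul1r ltr_pXn2r// nnegrE ltW.
  split.
    rewrite ler_pdivlMr// /g mulrDr.
    have h1 : c ^+ 2 * (tau * (C k / c ^+ 2)) = tau * C k by field; rewrite gt_eqF.
    have h2 : c ^+ 2 * ((1 - tau) / C k) <= (1 - tau) * C k.
      rewrite mulrCA ler_wpM2l ?subr_ge0// ler_pdivrMr// -expr2.
      by rewrite lerXn2r// nnegrE ltW.
    by rewrite h1; lra.
  rewrite -(ltr_pM2r (g0 k)) mulVf ?gt_eqF// gE.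
  have : tau * 1 < tau * (C k ^+ 2 / c ^+ 2) by rewrite ltr_pM2l.
  by lra.
Qed.

End schedule.

(** * A path along which finite-horizon workloads oscillate *)

Lemma downward_ind (P : nat -> Prop) (n : nat) :
  P n -> (forall i, (i < n)%N -> P i.+1 -> P i) -> forall i, (i <= n)%N -> P i.
Proof.
move=> Pn IH i; elim: n Pn IH => [|n IHn] Pn IH; first by rewrite leqn0 => /eqP ->.
rewrite leq_eqVlt => /predU1P[->//|]; rewrite ltnS; apply: IHn; first exact: IH.
by move=> j jn; apply: IH; exact: leqW.
Qed.

Lemma leq_clock p q : (p <= q)%N -> (clock p <= clock q)%N.
Proof.
move=> /subnKC <-; elim: (q - p)%N => [|n IH]; first by rewrite addn0.
by rewrite addnS; have [->//|->] := clockS (p + n); exact: leqW.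
Qed.

Section oscillation.
Context {R : realType} {K : nat} (C : 'I_K -> R) (H Hwc : orthant R 1 K -> simplex C).
Hypotheses (C_gt0 : forall k, 0 < C k).
Hypotheses (H_mw : max_weight H) (Hwc_wc : work_conserving H Hwc).
Context (k0 j0 : 'I_K).
Local Notation c := (C k0).
Local Notation m := (C j0).
Hypotheses (c_le : forall k, c <= C k) (cm : c < m).
Context (beta : 'I_K -> R) (sched : nat -> 'I_K) (eb : R) (N : nat).
Hypotheses (beta_ge0 : forall k, 0 <= beta k)
  (beta_large : forall k, c < C k -> c ^+ 2 <= C k * beta k)
  (beta_le : forall k, c < C k -> beta k + 2 * c * eb / C k <= C k).
Hypotheses (eb_gt0 : 0 < eb) (eb_le : 4 * eb <= c) (N_gt0 : (0 < N)%N)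
  (N_large : c * (c + 2 * eb) + c * (c + 2 * eb) / N%:R < m ^+ 2)
  (eb_small : c * (c + 2 * eb) / m ^+ 2 + 2 * (2 * eb) / c * K%:R <= 1).

(** The margins tend to 0 along the path because in the critical case
    [cost C mu = c ^+ 2] only batches of size exactly [c ^+ 2 / C k] have mean [mu],
    while a positive margin requires slightly larger ones. *)
Definition eps (g : nat) : R := eb * g.+1%:R^-1.
(** The weight of this batch lies strictly between those of the single and of the
    doubled residual. *)
Definition volume (g : nat) : R := c * (c + eps g + eps g.+1 / 2) / m.
Definition drain (g : nat) : R := m - volume g / N%:R.
Definition len : nat := (N + N).+3.
(** The blocks, of length [len], in which the residual is exchanged. *)
Definition event (q : nat) : bool := clock q.+1 != clock q.

(** The arrivals of an exchange.  Time runs backwards: the index [(N + N).+2] is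
    consumed first and the index [0] last. *)
Definition swap (g i : nat) (k : 'I_K) : R :=
  unit_at j0 (if i \in [:: 0; N.+1; (N + N).+2]%N then volume g else drain g) k +
  (if i == (N + N).+2 then level C k0 (eps g) k else 0).

Definition batch (g : nat) (j : 'I_K) : R :=
  if C j == c then c else beta j + 2 * c * eps g / C j.

Definition oscillating (s : nat) (k : 'I_K) : R :=
  let q := (s %/ len)%N in
  if event q then swap (clock q) (s %% len)%N k
  else unit_at (sched s) (batch (clock q) (sched s)) k.

Let c_gt0 : 0 < c := C_gt0 k0.
Let m_gt0 : 0 < m := C_gt0 j0.

Lemma eps_gt0 g : 0 < eps g.
Proof. by rewrite mulr_gt0// invr_gt0. Qed.

Lemma eps_le g : eps g <= eb.
Proof. by rewrite ger_pMr// invf_le1// ler1n. Qed.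

Lemma eps2_le g : 2 * eps g <= c.
Proof. by have := eps_le g; have := eb_le; have := eb_gt0; lra. Qed.

Lemma volumeE g : m * volume g = c * (c + eps g + eps g.+1 / 2).
Proof. by rewrite /volume mulrC divfK// gt_eqF. Qed.

Lemma volume_gt g : c * (c + eps g) < m * volume g.
Proof. by rewrite volumeE ltr_pM2l// ltrDl divr_gt0// eps_gt0. Qed.

Lemma volume_lt g : m * volume g < c * (c + (eps g + eps g.+1)).
Proof. by rewrite volumeE ltr_pM2l// addrA ltrD2l; have := eps_gt0 g.+1; lra. Qed.

Lemma volume_lt_eb g : m * volume g < c * (c + 2 * eb).
Proof.
apply: lt_le_trans (volume_lt g) _; rewrite ler_pM2l// lerD2l.
by have := eps_le g; have := eps_le g.+1; lra.
Qed.

Lemma eps_pair_le g : 2 * (eps g + eps g.+1) <= c.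
Proof. by have := eps_le g; have := eps_le g.+1; have := eb_le; lra. Qed.

Let Nr_gt0 : 0 < N%:R :> R. Proof. by rewrite ltr0n. Qed.

Lemma volume_gt0 g : 0 < volume g.
Proof.
rewrite -(pmulr_rgt0 _ m_gt0) (lt_trans _ (volume_gt g))// mulr_gt0// addr_gt0//.
exact: eps_gt0.
Qed.

Lemma drain_gt g : c * (c + (eps g + eps g.+1)) < m * drain g.
Proof.
apply: (@le_lt_trans _ _ (c * (c + 2 * eb))).
  by rewrite ler_pM2l// lerD2l; have := eps_le g; have := eps_le g.+1; lra.
have h : m * (volume g / N%:R) < c * (c + 2 * eb) / N%:R.
  by rewrite mulrA ltr_pM2r ?invr_gt0//; exact: volume_lt_eb.
by rewrite /drain mulrBr -expr2; have := N_large; lra.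
Qed.

Lemma drain_gt' g : c * (c + eps g) < m * drain g.
Proof.
apply: le_lt_trans (drain_gt g); rewrite ler_pM2l// lerD2l lerDl.
exact/ltW/eps_gt0.
Qed.

Lemma drain_le g : drain g <= m.
Proof. by rewrite /drain lerBlDr lerDl divr_ge0// ltW// volume_gt0. Qed.

Lemma volume_le g : volume g <= m.
Proof.
rewrite -(ler_pM2l m_gt0) (le_trans (ltW (volume_lt g)))//.
by rewrite (le_trans (ltW (drain_gt g)))// ler_pM2l//; exact: drain_le.
Qed.

Lemma volume_small g : volume g / m + (2 * (eps g + eps g.+1) / c) * K%:R <= 1.
Proof.
apply: le_trans eb_small; apply: lerD.
  rewrite ler_pdivrMr// expr2 invfM mulrA divfK ?gt_eqF// ler_pdivlMr// mulrC.
  exact/ltW/volume_lt_eb.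
rewrite ler_wpM2r// ler_pM2r ?invr_gt0//.
by have := eps_le g; have := eps_le g.+1; lra.
Qed.

Lemma batch_ge0 g j : 0 <= batch g j.
Proof.
rewrite /batch; case: ifP => _; first exact: ltW.
by rewrite addr_ge0// divr_ge0 ?mulr_ge0// ltW// eps_gt0.
Qed.

Lemma batch_le g j : batch g j <= C j.
Proof.
rewrite /batch; case: eqP => [->//|/eqP Cj].
have cj : c < C j by rewrite lt_neqAle eq_sym Cj c_le.
apply: le_trans (beta_le cj); rewrite lerD2l ler_pM2r ?invr_gt0//.
by rewrite ler_pM2l ?mulr_gt0//; exact: eps_le.
Qed.

(** At stage [g] the batches exceed [beta] by [2 * c * eps g / C j], twice what the
    margin [eps g] requires. *)
Lemma after_batch_level g j :
  after Hwc (level C k0 (eps g)) (unit_at j (batch g j)) (level C k0 (eps g)).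
Proof.
have e0 := eps_gt0 g; have e2 := eps2_le g.
have [Cj|Cj] := eqVneq (C j) c.
  by rewrite /batch Cj eqxx; exact: (after_batch_small C_gt0 H_mw Hwc_wc).
have cj : c < C j by rewrite lt_neqAle eq_sym Cj c_le.
apply: (after_batch_large C_gt0 H_mw Hwc_wc) => //; first exact: batch_le.
rewrite /batch (negbTE Cj).
have -> : C j * (beta j + 2 * c * eps g / C j) = C j * beta j + 2 * c * eps g.
  by field; rewrite gt_eqF.
have := beta_large cj; have : 0 < c * eps g by rewrite mulr_gt0.
by rewrite mulrDr -expr2; lra.
Qed.

Context (a : nat -> orthant R 1 K).
Hypothesis aE : forall s k, omx (a s) 0 k = oscillating s k.

(** What is left at time [- s] when the system starts empty at time [- T]. *)
Definition backlog (T s : nat) (x : 'I_K -> R) :=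
  forall k, leftover Hwc (run Hwc (past s a) (T - s)) k = x k.

Lemma backlog_step T s x z y : (s < T)%N -> oscillating s =1 z ->
  after Hwc x z y -> backlog T s.+1 x -> backlog T s y.
Proof.
move=> sT zE xy Sx k; rewrite /backlog -(subnSK sT); apply: xy => {}k.
rewrite runSE -Sx /past addn0 aE zE; congr (leftover Hwc _ k + _).
by apply: eq_run => i _; rewrite addnA addn1.
Qed.

Lemma oscillating_swap q i : event q -> (i < len)%N ->
  oscillating (q * len + i) =1 swap (clock q) i.
Proof.
move=> eq il k; rewrite /oscillating divnMDl// divn_small// addn0 eq.
by rewrite modnMDl modn_small.
Qed.

Lemma oscillating_batch q i : ~~ event q -> (i < len)%N ->
  oscillating (q * len + i) =1
  unit_at (sched (q * len + i)) (batch (clock q) (sched (q * len + i))).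
Proof.
by move=> /negbTE eq il k; rewrite /oscillating divnMDl// divn_small// addn0 eq.
Qed.

Lemma backlog_regular T q x : ~~ event q -> (q.+1 * len <= T)%N ->
  x = (fun=> 0) \/ x = level C k0 (eps (clock q)) ->
  backlog T (q.+1 * len) x -> forall i, (i <= len)%N -> backlog T (q * len + i) x.
Proof.
move=> eq qT xE Sx; apply: downward_ind; first by rewrite addnC -mulSn.
move=> i il; rewrite addnS; apply: backlog_step.
- by rewrite (leq_trans _ qT)// mulSn addnC ltn_add2r.
- exact: oscillating_batch.
- case: xE => ->; last exact: after_batch_level.
  by apply: (after_batch0 C_gt0 H_mw Hwc_wc); rewrite batch_ge0 batch_le.
Qed.

(** Every step of the exchange is a winning batch for the new residual. *)
Lemma backlog_swap_first T q : event q -> (q.+1 * len <= T)%N ->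
  backlog T (q.+1 * len) (fun=> 0) -> backlog T (q * len) (level C k0 (eps (clock q))).
Proof.
move=> eq qT; set g := clock q; rewrite mulSn addnC [X in (_ + X)%N]/len addnS => S0.
have lT i : (i < len)%N -> (q * len + i < T)%N.
  by move=> il; rewrite (leq_trans _ qT)// mulSn addnC ltn_add2r.
rewrite -[(q * len)%N]addn0.
apply: (@downward_ind (fun i => backlog T (q * len + i) (level C k0 (eps g))) (N + N).+2) => //.
  apply: backlog_step S0.
  - exact: lT.
  - exact: oscillating_swap.
  - rewrite /swap eqxx !inE eqxx !orbT -/g.
    by apply: (after_swap_first C_gt0 H_mw Hwc_wc cm (e' := eps g.+1) (N := N));
      rewrite ?eps_gt0 ?eps_pair_le ?volume_gt ?volume_lt//; exact: drain_gt.
move=> i iN; rewrite addnS; apply: backlog_step.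
- by apply: lT; exact: leqW.
- by apply: oscillating_swap => //; exact: leqW.
- have -> : swap (clock q) i = unit_at j0
      (if i \in [:: 0; N.+1; (N + N).+2]%N then volume g else drain g).
    by apply/funext => k; rewrite /swap (ltn_eqF iN) addr0.
  apply: (after_batch_large C_gt0 H_mw Hwc_wc) => //.
  + exact: eps_gt0.
  + exact: eps2_le.
  + by case: ifP => _; [exact: volume_le|exact: drain_le].
  + by case: ifP => _; [exact: volume_gt|exact: drain_gt'].
Qed.

(** The work waiting at [j0] is [volume g] after the start and after the test,
    and is drained linearly in [N] steps both times; [r n] is the work left when
    [n] of these steps remain. *)
Lemma backlog_swap_second T q : event q -> (q.+1 * len <= T)%N ->
  backlog T (q.+1 * len) (level C k0 (eps (clock q).+1)) -> backlog T (q * len) (fun=> 0).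
Proof.
move=> eq qT; set g := clock q; rewrite mulSn addnC [X in (_ + X)%N]/len addnS => S0.
have lT i : (i < len)%N -> (q * len + i < T)%N.
  by move=> il; rewrite (leq_trans _ qT)// mulSn addnC ltn_add2r.
have e0 := eps_gt0 g; have e1 := eps_gt0 g.+1; have e2 := eps_pair_le g.
have v0 := volume_gt0 g; have vlt := volume_lt g.
have swapE i b : (i < (N + N).+2)%N ->
    (if i \in [:: 0; N.+1; (N + N).+2]%N then volume g else drain g) = b ->
    oscillating (q * len + i) =1 unit_at j0 b.
  move=> iN bE k; rewrite oscillating_swap ?(leqW iN)// /swap -/g bE.
  by rewrite (ltn_eqF iN) addr0.
pose r n : R := volume g * n%:R / N%:R.
have rS n : r n.+1 - volume g / N%:R = r n.
  by rewrite /r -natr1 mulrDr mulr1 mulrDl addrK.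
have r0 : r 0%N = 0 by rewrite /r mulr0 mul0r.
have rN : r N = volume g by rewrite /r mulfK// gt_eqF.
have r_ge0 n : 0 <= r n by rewrite /r divr_ge0// mulr_ge0// ltW.
have r_drain n : m <= r n.+1 + (m - volume g / N%:R).
  by have := rS n; have := r_ge0 n; lra.
have S1 : backlog T (q * len + (N + N).+2) (high C k0 j0 (eps g) (eps g.+1) (r N)).
  apply: backlog_step S0.
  - exact: lT.
  - exact: oscillating_swap.
  - rewrite rN /swap eqxx !inE eqxx !orbT -/g.
    exact: (after_high_start C_gt0 H_mw Hwc_wc cm).
have S2 : forall n, (n <= N)%N ->
    backlog T (q * len + (N.+2 + n)) (high C k0 j0 (eps g) (eps g.+1) (r n)).
  apply: downward_ind; first by rewrite !addSn.
  move=> n nN.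
  have -> : (q * len + (N.+2 + n.+1) = (q * len + (N.+2 + n)).+1)%N by rewrite !addnS.
  apply: backlog_step.
  - by apply: lT; rewrite /len !addSn !ltnS leq_add2l ltnW.
  - apply: (@swapE _ (drain g)); first by rewrite !addSn !ltnS ltn_add2l.
    by rewrite !inE !addSn !eqSS /= gtn_eqF ?ltnS ?leq_addr//= eqn_add2l ltn_eqF.
  - rewrite -(rS n); apply: (after_high C_gt0 H_mw Hwc_wc cm) => //.
    exact: drain_gt.
have S3 : backlog T (q * len + N.+1) (low C k0 j0 (eps g) (eps g.+1) (r N)).
  have := S2 0%N isT; rewrite r0 addn0 addnS; apply: backlog_step.
  - by apply: lT; rewrite /len !ltnS leqW// leq_addr.
  - apply: swapE; first by rewrite !ltnS leq_addr.
    by rewrite !inE eqxx orbT.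
  - by rewrite rN; exact: (after_test C_gt0 H_mw Hwc_wc cm).
have S4 : forall n, (n <= N)%N ->
    backlog T (q * len + n.+1) (low C k0 j0 (eps g) (eps g.+1) (r n)).
  apply: downward_ind => // n nN.
  have -> : (q * len + n.+2 = (q * len + n.+1).+1)%N by rewrite addnS.
  apply: backlog_step.
  - by apply: lT; rewrite /len !ltnS (leq_trans (ltnW nN))// leqW// leq_addr.
  - apply: (@swapE _ (drain g)).
      by rewrite !ltnS (leq_trans (ltnW nN))// leq_addr.
    rewrite !inE /= !eqSS (ltn_eqF nN)/= ltn_eqF// ltnS.
    by rewrite (leq_trans (ltnW nN))// leq_addr.
  - rewrite -(rS n); exact: (after_low C_gt0 H_mw Hwc_wc cm).
rewrite -[(q * len)%N]addn0; have := S4 0%N isT; rewrite r0 addn1.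
rewrite -[X in backlog T X.+1]addn0; apply: backlog_step.
- exact: lT.
- by apply: swapE => //; rewrite inE eqxx.
- by apply: (after_low_end C_gt0 H_mw Hwc_wc) => //; exact: volume_small.
Qed.

(** Starting empty at a block boundary, the residual is present exactly after
    an odd number of exchanges. *)
Lemma backlog_blocks Q q : (q <= Q)%N -> backlog (Q * len) (q * len)
  (if odd (clock Q - clock q) then level C k0 (eps (clock q)) else fun=> 0).
Proof.
move: q; apply: downward_ind => [|q qQ].
  rewrite subnn /= => k; rewrite subnn/=; exact: (leftover_ozero C_gt0 H_mw Hwc_wc).
have qT : (q.+1 * len <= Q * len)%N by rewrite leq_mul2r qQ orbT.
have cQ := leq_clock qQ.
have [E|E] := clockS q; rewrite E.
  move=> /(backlog_regular _ qT _)/(_ 0%N isT); rewrite addn0; apply.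
    by rewrite /event E eqxx.
  by case: ifP => _; [right|left].
have ev : event q by rewrite /event E gtn_eqF.
rewrite E in cQ; rewrite -(subnSK cQ) /=; case: ifP => /= _ S.
  exact: (backlog_swap_second ev qT S).
exact: (backlog_swap_first ev qT S).
Qed.

Lemma run_oscillating Q : (0 < Q)%N -> omx (run Hwc a (Q * len)) 0 k0 =
  oscillating 0 k0 + (if odd (clock Q) then c + eps 0 else 0).
Proof.
move=> Q0; have := backlog_blocks Q0; rewrite subn0 => S1.
have qT : (1 * len <= Q * len)%N by rewrite leq_mul2r Q0 orbT.
have : backlog (Q * len) (0 * len + 1)
    (if odd (clock Q) then level C k0 (eps 0) else fun=> 0).
  apply: (@backlog_regular _ 0 _ _ qT) => //.
  by case: ifP => _; [right|left].
rewrite add0n /backlog => /(_ k0) S.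
have -> : (Q * len)%N = (Q * len - 1).+1 by rewrite subn1 prednK// muln_gt0 Q0.
rewrite runSE S aE addrC; congr (_ + _); case: ifP => // _.
by rewrite /level /margin /unit_at eqxx.
Qed.

(** Moving the horizon over one more exchange changes the parity, hence the
    workload of [k0] by more than [c]. *)
Lemma run_oscillating_diverges : ~ cvgn (fun T => run Hwc a T).
Proof.
move=> /cvg_ex[/= l al].
have c20 : 0 < c / 2 by rewrite divr_gt0.
have : nbhs l [set b : orthant R 1 K | `|omx l 0 k0 - omx b 0 k0| < c / 2].
  by apply/nbhs_orthantP; exists (c / 2) => // b lb; exact: lb.
move=> /al[n _ Hn].
have [q nq Eq] := clock_ticks n.+1.
have q0 : (0 < q)%N by exact: leq_trans nq.
have nql p : (n < p)%N -> (n <= p * len)%N.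
  by move=> np; rewrite (leq_trans (ltnW np))// leq_pmulr.
have dist p : (n < p)%N -> `|omx l 0 k0 - omx (run Hwc a (p * len)) 0 k0| < c / 2.
  by move=> np; exact: Hn _ (nql p np).
have := dist _ nq; have := dist _ (leqW nq); rewrite !run_oscillating// Eq oddS; have := eps_gt0 0.
by case: (odd _) => /= e0; rewrite !ltr_norml => /andP[? ?] /andP[? ?]; lra.
Qed.

End oscillation.

(** * The mean rate of the oscillating path *)

Lemma cesaro_cumul (R : realType) (u : nat -> R) (l : R) :
  u @ \oo --> l -> (cumul u t / t%:R) @[t --> \oo] --> l.
Proof.
move=> /cesaro ul; rewrite -cvg_shiftS; apply: cvg_trans ul; apply: near_eq_cvg.
by apply: nearW => n; rewrite /arithmetic_mean /series/= /cumul big_mkord mulrC.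
Qed.

Lemma cumul_addn (R : realType) (f : nat -> R) p q :
  cumul f (p + q) = cumul f p + \sum_(i < q) f (p + i)%N.
Proof. by rewrite /cumul big_split_ord. Qed.

Section mean.
Context {R : realType} {K : nat} (C : 'I_K -> R).
Hypotheses (C_gt0 : forall k, 0 < C k).
Context (k0 j0 : 'I_K).
Local Notation c := (C k0).
Local Notation m := (C j0).
Hypotheses (c_le : forall k, c <= C k) (cm : c < m).
Context (beta : 'I_K -> R) (sched : nat -> 'I_K) (eb : R) (N : nat).
Hypotheses (beta_ge0 : forall k, 0 <= beta k)
  (beta_small : forall k, C k = c -> beta k = c)
  (beta_le : forall k, c < C k -> beta k + 2 * c * eb / C k <= C k).
Hypotheses (eb_gt0 : 0 < eb) (eb_le : 4 * eb <= c) (N_gt0 : (0 < N)%N)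
  (N_large : c * (c + 2 * eb) + c * (c + 2 * eb) / N%:R < m ^+ 2).
Local Notation osc := (oscillating C k0 j0 beta sched eb N).
Let c_gt0 : 0 < c := C_gt0 k0.
Let m_gt0 : 0 < m := C_gt0 j0.

Lemma swap_ge0 g i k : 0 <= swap C k0 j0 eb N g i k.
Proof.
have e0 := eps_gt0 eb_gt0 g.
have d0 : 0 < drain C k0 j0 eb N g.
  rewrite -(pmulr_rgt0 _ m_gt0).
  apply: lt_trans (drain_gt C_gt0 eb_gt0 N_gt0 N_large g).
  by rewrite mulr_gt0// !addr_gt0//; exact: eps_gt0.
have v0 := volume_gt0 C_gt0 k0 j0 eb_gt0 g.
rewrite /swap addr_ge0//.
  by rewrite /unit_at; case: ifP => // _; case: ifP => _; exact: ltW.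
case: ifP => // _; rewrite /level /unit_at /margin; have hc := c_gt0.
by case: ifP => _; [lra|case: ifP => _; lra].
Qed.

Lemma swap_le g i k : swap C k0 j0 eb N g i k <= m + 2 * c.
Proof.
have e0 := eps_gt0 eb_gt0 g; have hc := c_gt0; have hm := m_gt0.
have d_le := drain_le C_gt0 k0 j0 N eb_gt0 g.
have v_le := volume_le C_gt0 eb_gt0 N_gt0 N_large g.
have e2 := eps2_le eb_gt0 eb_le g.
rewrite /swap lerD//.
  by rewrite /unit_at; case: ifP => _; [case: ifP|lra].
case: ifP => _; last lra.
by rewrite /level /unit_at /margin; case: ifP => _; [lra|case: ifP => _; lra].
Qed.

Lemma osc_ge0 s k : 0 <= osc s k.
Proof.
rewrite /oscillating; case: ifP => _; first exact: swap_ge0.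
rewrite /unit_at; case: ifP => // _.
exact: (batch_ge0 C_gt0 _ beta_ge0 eb_gt0).
Qed.

Lemma beta_leC k : beta k <= C k.
Proof.
have [Ck|Ck] := eqVneq (C k) c; first by rewrite beta_small// Ck.
have ck : c < C k by rewrite lt_neqAle eq_sym Ck c_le.
apply: le_trans (beta_le ck); rewrite lerDl; apply: divr_ge0; last exact: ltW.
by rewrite mulr_ge0 ?ltW// mulr_gt0.
Qed.

(** Compared with batches [beta] at the prescribed frequencies, the path has an
    error of order [eps] in the regular blocks, and a bounded error in the others. *)
Lemma osc_error s k :
  `|osc s k - beta k * (sched s == k)%:R| <=
  2 * eps eb (clock (s %/ len N)) + (m + 2 * c + C k) * (event (s %/ len N))%:R.
Proof.
have e0 := eps_gt0 eb_gt0 (clock (s %/ len N)).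
have hc := c_gt0; have hm := m_gt0; have hk := C_gt0 k.
rewrite /oscillating; case: ifP => _; rewrite ?mulr1 ?mulr0 ?addr0.
  have h0 := swap_ge0 (clock (s %/ len N)) (s %% len N) k.
  have h1 := swap_le (clock (s %/ len N)) (s %% len N) k.
  have b0 := beta_ge0 k; have b1 := beta_leC k.
  by case: (sched s == k); rewrite ?mulr1 ?mulr0 ler_norml; apply/andP; split; lra.
rewrite /unit_at eq_sym; have [->|_] := eqVneq (sched s) k; last first.
  by rewrite mulr0 subrr normr0; lra.
rewrite mulr1 /batch; case: eqP => [/beta_small ->|_].
  by rewrite subrr normr0; lra.
rewrite addrAC subrr add0r ger0_norm; last by rewrite divr_ge0 ?mulr_ge0 ?ltW.
by rewrite ler_pdivrMr//; have := ler_wpM2l (ltW e0) (c_le k); lra.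
Qed.

(** Each tick of the clock accounts for one exceptional block. *)
Lemma cumul_event t :
  cumul (fun s => (event (s %/ len N))%:R : R) t <= (len N)%:R * (clock t)%:R.
Proof.
have E q : cumul (fun s => (event (s %/ len N))%:R : R) (q * len N) =
    (len N)%:R * (clock q)%:R.
  elim: q => [|q IH]; first by rewrite /cumul big_ord0 mulr0.
  rewrite mulSn addnC cumul_addn IH.
  rewrite (eq_bigr (fun=> (event q)%:R)) => [|i _]; last first.
    by rewrite /= divnMDl// divn_small// addn0.
  rewrite sumr_const card_ord -[_%:R *+ len N]mulr_natl -mulrDr -natrD; congr (_ * _%:R).
  rewrite /event; have [->|->] := clockS q; first by rewrite eqxx addn0.
  by rewrite gtn_eqF// addn1.
have tl : (t <= t * len N)%N by rewrite leq_pmulr.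
rewrite -E -(subnKC tl) cumul_addn lerDl.
by apply: sumr_ge0 => i _; exact: ler0n.
Qed.

Lemma eps_clock_cvg0 : (eps eb (clock (s %/ len N))) @[s --> \oo] --> 0.
Proof.
have e0 : eps eb @ \oo --> 0.
  have h := cvgM (_ : (fun=> eb) @ \oo --> eb) (@cvg_harmonic R).
  by rewrite mulr0 in h; apply: h; exact: cvg_cst.
apply: (@cvg_comp _ _ _ (fun s => clock (s %/ len N)) (eps eb) \oo \oo) e0.
move=> A [M _ MA]; have [q0 _ Hq] := clock_pinfty M.
exists (q0 * len N)%N => // s /= qs; apply: MA; apply: Hq => /=.
by rewrite leq_divRL.
Qed.

(** Both kinds of errors vanish on average: the first by Cesaro, the second
    because exceptional blocks have density zero. *)
Lemma cumul_oscillating (p : 'I_K -> R) k :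
  (cumul (fun s => (sched s == k)%:R : R) t / t%:R) @[t --> \oo] --> p k ->
  (cumul (osc^~ k) t / t%:R) @[t --> \oo] --> beta k * p k.
Proof.
move=> pk; pose err s := osc s k - beta k * (sched s == k)%:R.
have oscE t : cumul (osc^~ k) t / t%:R =
    beta k * (cumul (fun s => (sched s == k)%:R : R) t / t%:R) + cumul err t / t%:R.
  rewrite mulrA -mulrDl; congr (_ / _).
  by rewrite /cumul mulr_sumr -big_split/=; apply: eq_bigr => s _; rewrite /err addrC subrK.
rewrite (_ : (fun t => cumul (osc^~ k) t / t%:R) = (fun t =>
    beta k * (cumul (fun s => (sched s == k)%:R : R) t / t%:R) + cumul err t / t%:R)); last first.
  by apply/funext => t; exact: oscE.
rewrite -[X in _ --> X]addr0; apply: cvgD.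
  by apply: cvgM => //; exact: cvg_cst.
pose bd t := 2 * (cumul (fun s => eps eb (clock (s %/ len N))) t / t%:R) +
  (m + 2 * c + C k) * (len N)%:R * ((clock t)%:R / t%:R).
have bd0 : bd @ \oo --> 0.
  have h1 := cvgM (_ : (fun=> 2 : R) @ \oo --> (2 : R)) (cesaro_cumul eps_clock_cvg0).
  have h2 := cvgM (_ : (fun=> (m + 2 * c + C k) * (len N)%:R) @ \oo -->
    (m + 2 * c + C k) * (len N)%:R) (@clock_le_cvg0 R).
  have h := cvgD (h1 _ (cvg_cst _)) (h2 _ (cvg_cst _)).
  by rewrite !mulr0 addr0 in h; exact: h.
have nbd0 : (fun t => - bd t) @ \oo --> 0.
  by have h := cvgN bd0; rewrite oppr0 in h; exact: h.
apply: squeeze_cvgr nbd0 bd0; apply: nearW => t.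
suff : `|cumul err t / t%:R| <= bd t by rewrite ler_norml.
have [->|t0] := posnP t; first by rewrite /bd /cumul !big_ord0 !mul0r normr0 !mulr0 addr0.
have tR : 0 < t%:R :> R by rewrite ltr0n.
rewrite normrM [X in _ * X]ger0_norm// ler_pdivrMr//.
rewrite (_ : bd t * t%:R = 2 * cumul (fun s => eps eb (clock (s %/ len N))) t +
  (m + 2 * c + C k) * ((len N)%:R * (clock t)%:R)); last first.
  by rewrite /bd; field; rewrite gt_eqF.
apply: (@le_trans _ _ (2 * cumul (fun s => eps eb (clock (s %/ len N))) t +
  (m + 2 * c + C k) * cumul (fun s => (event (s %/ len N))%:R : R) t)); last first.
  rewrite lerD2l ler_wpM2l ?cumul_event//.
  by rewrite !addr_ge0 ?mulr_ge0// ltW.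
rewrite /cumul !mulr_sumr -big_split/= (le_trans (ler_norm_sum _ _ _))//.
by apply: ler_sum => s _; exact: osc_error.
Qed.

End mean.

Section divergence.
Context {R : realType} {K : nat} (C : 'I_K -> R) (H Hwc : orthant R 1 K -> simplex C).
Hypotheses (C_gt0 : forall k, 0 < C k).
Hypotheses (H_mw : max_weight H) (Hwc_wc : work_conserving H Hwc).

Lemma region_int_load (mu : 'rV[R]_K) : (0 < K)%N -> region_int (simplex C) mu ->
  \sum_k mu 0 k / C k < 1.
Proof.
move=> K0 [_ [l [_ l1] mul]]; apply: lt_le_trans l1; apply: ltr_sum => [|k _].
  by apply/hasP; exists (Ordinal K0); rewrite ?mem_index_enum.
by rewrite ltr_pM2r ?invr_gt0.
Qed.

(** If the minimal cost decrease does not exceed the mean cost of the arrivals,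
    a residual can survive forever, and the oscillating path has mean [mu].  Some
    rate exceeds the smallest one, since otherwise the condition on the cost would
    say that the load is at least 1. *)
Lemma divergent_arrivals (mu : 'rV[R]_K) (k0 : 'I_K) :
  region_int (simplex C) mu -> (forall k, C k0 <= C k) ->
  C k0 ^+ 2 <= cost C (mu 0) ->
  exists a : arrivals mu, ~ cvgn (fun T => workload Hwc (window a T)).
Proof.
move=> mu_int c_le mu_ge.
have K0 : (0 < K)%N := leq_ltn_trans (leq0n k0) (ltn_ord k0).
have rho1 := region_int_load K0 mu_int.
have mu0 k : 0 <= mu 0 k by have [[+ _] _] := mu_int; exact.
have c0 := C_gt0 k0; set c := C k0 in c0 c_le mu_ge.
have [j0 cm] : exists j0, c < C j0.
  apply: contrapT => /forallNP nC.
  have CE k : C k = c by apply/eqP; rewrite eq_le c_le andbT leNgt; exact/negP.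
  have : cost C (mu 0) < c ^+ 2.
    rewrite -[ltRHS]mulr1; apply: le_lt_trans (_ : c ^+ 2 * (\sum_k mu 0 k / C k) < _).
      rewrite mulr_sumr; apply: ler_sum => k _; rewrite CE.
      by rewrite (_ : c ^+ 2 * (mu 0 k / c) = c * mu 0 k)//; field; rewrite gt_eqF.
    by rewrite ltr_pM2l// exprn_gt0.
  by rewrite ltNge mu_ge.
have [p [beta [p0 p1 betap beta_small beta_large]]] :=
  batch_sizes C_gt0 c0 c_le mu0 rho1 mu_ge.
have m0 := C_gt0 j0; set m := C j0 in m0 cm.
have m20 : 0 < m ^+ 2 by rewrite exprn_gt0.
have beta0 k : 0 <= beta k.
  have [Ck|Ck] := eqVneq (C k) c; first by rewrite beta_small// ltW.
  have /beta_large[+ _] : c < C k by rewrite lt_neqAle eq_sym Ck c_le.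
  by move=> h; rewrite -(pmulr_rge0 _ (C_gt0 k)) (le_trans _ h)// sqr_ge0.
(* Up to [f j], the batches at queue [j] stay below [C j]. *)
pose f j := if c < C j then (C j - beta j) * C j / (2 * c) else 1.
have f0 j : 0 < f j.
  rewrite /f; case: ifP => // /beta_large[_ bC].
  by rewrite divr_gt0// mulr_gt0// subr_gt0.
have [e1 e10 He1] := finite_lower_bound f0.
have Kr : 1 <= K%:R :> R by rewrite ler1n.
pose gap := 1 - c ^+ 2 / m ^+ 2.
have gap0 : 0 < gap.
  by rewrite subr_gt0 ltr_pdivrMr// mul1r ltr_pXn2r// nnegrE ltW.
(* The third bound makes the final remainder of an exchange fit in the
   simplex: [v / C j0] is close to [c ^+ 2 / C j0 ^+ 2 = 1 - gap]. *)
pose eb := Num.min e1 (Num.min (c / 4) (c * gap / (4 * K%:R + 2))).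
have den0 : 0 < 4 * K%:R + 2 :> R by lra.
have eb0 : 0 < eb by rewrite !lt_min e10 !divr_gt0// mulr_gt0.
have eb_e1 : eb <= e1 by rewrite ge_min lexx.
have eb_c : eb <= c / 4 by rewrite !ge_min lexx orbT.
have eb_gap : eb * (4 * K%:R + 2) <= c * gap.
  by rewrite -ler_pdivlMr// !ge_min lexx !orbT.
have beta_le k : c < C k -> beta k + 2 * c * eb / C k <= C k.
  move=> ck; have := He1 k; rewrite /f ck => /(le_trans eb_e1).
  rewrite ler_pdivlMr ?mulr_gt0// => h.
  have h' : 2 * c * eb / C k <= C k - beta k by rewrite ler_pdivrMr// mulrC.
  by move: h'; lra.
have eb_small : c * (c + 2 * eb) / m ^+ 2 + 2 * (2 * eb) / c * K%:R <= 1.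
  have h1 : c ^+ 2 <= m ^+ 2 by rewrite ler_pXn2r ?nnegrE// ltW.
  have h2 : c * (2 * eb) / m ^+ 2 <= 2 * eb / c.
    rewrite (_ : c * (2 * eb) / m ^+ 2 = 2 * eb / c * (c ^+ 2 / m ^+ 2)); last first.
      by field; rewrite !gt_eqF.
    rewrite ger_pMr; last by rewrite divr_gt0// mulr_gt0.
    by rewrite ler_pdivrMr// mul1r.
  have h3 : eb * (4 * K%:R + 2) / c <= gap by rewrite ler_pdivrMr// (mulrC gap).
  rewrite mulrDr mulrDl -expr2.
  have E : eb * (4 * K%:R + 2) / c = 2 * (2 * eb) / c * K%:R + 2 * eb / c by field; rewrite gt_eqF.
  by move: h2 h3; rewrite E /gap; lra.
pose x := c * (c + 2 * eb).
have xm : x < m ^+ 2.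
  have : 0 < 2 * (2 * eb) / c * K%:R by rewrite mulr_gt0// ?divr_gt0 ?mulr_gt0// ltr0n.
  by move=> h; rewrite -[ltRHS]mul1r -ltr_pdivrMr//; move: eb_small; rewrite -/x; lra.
have x0 : 0 < x by rewrite mulr_gt0// addr_gt0// mulr_gt0.
pose N := (Num.bound (x / (m ^+ 2 - x))).+1.
have NR : 0 < N%:R :> R by rewrite ltr0n.
have N_large : x + x / N%:R < m ^+ 2.
  rewrite -ltrBrDl ltr_pdivrMr// mulrC -ltr_pdivrMr ?subr_gt0//.
  apply: lt_trans (archi_boundP _) _; last by rewrite ltr_nat.
  by rewrite divr_ge0// ltW// subr_gt0.
have eb4 : 4 * eb <= c by lra.
pose osc := oscillating C k0 j0 beta (next_batch p k0) eb N.
have [a aE] : exists a : arrivals mu, forall k s, arrival a k s = osc s k.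
  apply: arrivals_of_mean.
    by move=> s k; exact: osc_ge0.
  move=> k; rewrite -betap; apply: (cumul_oscillating C_gt0) => //.
  exact: next_batch_frequency.
exists a; rewrite (_ : (fun T => _) = run Hwc (slice a)); last first.
  by apply/funext => T; exact: workload_window.
apply: (run_oscillating_diverges C_gt0 H_mw Hwc_wc c_le cm
  (beta := beta) (sched := next_batch p k0) (eb := eb) (N := N)) => //.
  by move=> k /beta_large[].
by move=> s k; rewrite sliceE aE.
Qed.

End divergence.

(** * The large deviation principle *)

Theorem theorem3 (R : realType) (K : nat) (C : 'I_K -> R) (mu : 'rV[R]_K)
  (H Hwc : orthant R 1 K -> simplex C)
  (d : nat -> measure_display) (Omega : forall n, measurableType (d n))
  (P : forall n, probability (Omega n) R)
  (A : forall n, Omega n -> arrivals mu)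
  (I : arrivals mu -> \bar R) (It : forall t : nat, orthant R K t -> \bar R)
  (K_gt0 : (0 < K)%N) (C_gt0 : forall k, 0 < C k)
  (H_qc : quasi_continuous H) (Hwc_qc : quasi_continuous Hwc)
  (H_mw : max_weight H) (Hwc_wc : work_conserving H Hwc)
  (mu_int : region_int (simplex C) mu)
  (workload_cvg : forall a : arrivals mu,
     cvgn (fun T : nat => workload Hwc (window a T)))
  (A_random : forall n, random_element (A n))
  (W_random : forall n, random_element (fun w => workload_infty Hwc (A n w)))
  (A_stationary : forall n k, stationary (P n) (fun w => arrival (A n w) k))
  (A_independent : forall n, independent_queues (P n) (A n))
  (A_mean : forall n k s,
     'E_(P n)[fun w => arrival (A n w) k s]%E = (mu 0 k)%:E)
  (A_ldp : ldp P A I)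
  (window_ldp : forall t : nat, (0 < t)%N ->
     ldp P (fun n w => window (A n w) t) (It t))
  (I_sup : forall a : arrivals mu,
     I a = ereal_sup [set It t (window a t) | t in [set t : nat | (0 < t)%N]])
  (I_lim : forall a : arrivals mu,
     It t (window a t) @[t --> \oo] --> I a)
  (It_continuous : forall t : nat, (0 < t)%N -> continuous (It t))
  (I_tail : forall (a : arrivals mu) (u : nat -> arrivals mu),
     (I a < +oo)%E -> u @ \oo --> a ->
     (exists2 t : nat, (0 < t)%N &
        forall n k s, (t <= s)%N -> arrival (u n) k s = arrival a k s) ->
     I (u n) @[n --> \oo] --> I a) :
  ldp P (fun n w => workload_infty Hwc (A n w))
    (fun b : orthant R 1 K =>
       ereal_inf [set I a | a in
         [set a : arrivals mu | cluster_set (@workload_infty R K C Hwc mu) a b]]).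
Proof.
pose k0 := [arg min_(k < Ordinal K_gt0) C k]%O.
have c_le k : C k0 <= C k.
  by rewrite /k0; case: Order.TotalTheory.arg_minP => //= j _; exact.
have mu_lt : cost C (mu 0) < C k0 ^+ 2.
  rewrite ltNge; apply/negP => mu_ge.
  have [a] := divergent_arrivals C_gt0 H_mw Hwc_wc mu_int c_le mu_ge.
  by apply; exact: workload_cvg.
apply: ldp_contraction A_ldp => //.
- exact: arrivals_hausdorff.
- exact: orthant_hausdorff.
- exact: arrivals_nbhs_sequence.
- exact: (workload_infty_bounded C_gt0 H_mw Hwc_wc (C_gt0 k0) c_le mu_lt).
- move=> x y U r.
  exact: (workload_infty_approximation C_gt0 K_gt0 H_mw Hwc_wc H_qc
    (C_gt0 k0) c_le mu_lt I_tail).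
Qed.
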